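(* Let $K$ be a pathwise connected poset, $\mathfrak{T}$ a DR-presheaf over $K$, $\varrho\in\mathrm{obj}\,\widetilde{\mathfrak{T}}$ a section, with associated compact Lie group $G_\varrho\subseteq\mathbb{U}(d)$, normalizer $NG_\varrho$ in $\mathbb{U}(d)$, quotient map $q:NG_\varrho\to QG_\varrho=NG_\varrho/G_\varrho$ and holonomy $\chi_\varrho:\pi_1(K)\to QG_\varrho$. Then $\varrho$ defines a cochain $\mathbf{u}_\varrho:\Sigma_1(K)\to NG_\varrho$ such that $$d\mathbf{u}_\varrho(c):=\mathbf{u}_\varrho(\partial_0c)\,\mathbf{u}_\varrho(\partial_2c)\,\mathbf{u}_\varrho(\partial_1c)^*\in G_\varrho,\qquad\forall c\in\Sigma_2(K).$$ The (possible) lifts of $\chi_\varrho$ to $NG_\varrho$, i.e. morphisms $\widetilde\chi_\varrho:\pi_1(K)\to NG_\varrho$ with $q\circ\widetilde\chi_\varrho=\chi_\varrho$, are in one-to-one correspondence with pairs $(v,g)$, $v:\Sigma_0(K)\to NG_\varrho$, $g:\Sigma_1(K)\to G_\varrho$, such that $$z(b):=v(\partial_0b)\,g(b)\,\mathbf{u}_\varrho(b)\,v(\partial_1b)^*\in NG_\varrho,\qquad\forall b\in\Sigma_1(K),$$ is a cocycle, i.e. $dz(c):=z(\partial_0c)z(\partial_2c)z(\partial_1c)^*=1$ for all $c\in\Sigma_2(K)$.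
   Context: Posets. $\Sigma_0(K)=K$. $\Sigma_1(K)$ is the set of triples $b=(\partial_0b,\partial_1b;|b|)$ of elements of $K$ with $\partial_0b,\partial_1b\le|b|$. $\Sigma_2(K)$ is the set of $c=(\partial_0c,\partial_1c,\partial_2c,|c|)$ with $|c|\in K$, $\partial_kc\in\Sigma_1(K)$, $|\partial_kc|\le|c|$, and $\partial_0\partial_0c=\partial_0\partial_1c$, $\partial_1\partial_0c=\partial_0\partial_2c$, $\partial_1\partial_1c=\partial_1\partial_2c$. A path $\gamma:o\to o'$ is a finite sequence $(b_n,\dots,b_1)$ in $\Sigma_1(K)$ with $\partial_0b_i=\partial_1b_{i+1}$, $\partial_1b_1=o$, $\partial_0b_n=o'$; $*$ denotes composition (juxtaposition, right factor run first) and $\gamma^{-1}$ the reversed path (each $b$ replaced by the 1-simplex with faces exchanged and same support, in reversed order). $K$ is pathwise connected if any two elements are joined by a path. For a fixed $a\in K$, $K(a)$ is the set of paths $a\to a$ and $\pi_1(K)=K(a)/\sim$, where $\sim$ is generated by replacing an entry $\partial_1c$ by the consecutive entries $\partial_0c,\partial_2c$ ($\partial_2c$ run first) and vice versa, $c\in\Sigma_2(K)$. Presheaves. A presheaf of $C^*$-categories $\mathfrak{T}=(T,r)^K$ is a family of $C^*$-categories $T_o$ with $*$-functors $r_{oo'}:T_{o'}\to T_o$, $o\le o'$, injective on the sets of arrows, with $r_{oo'}\circ r_{o'o''}=r_{oo''}$. It is a presheaf bundle if all $r_{oo'}$ are isomorphisms. It is a symmetric tensor presheaf with simple units if every $T_o$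 is a symmetric tensor $C^*$-category with $(\iota_o,\iota_o)\simeq\mathbb{C}$ ($\iota_o$ the identity object) and all $r_{oo'}$ preserve tensor products and symmetries. The section category $\widetilde{\mathfrak{T}}$ has objects the families $\varrho=\{\varrho_o\in\mathrm{obj}\,T_o\}$ with $r_{oo'}(\varrho_{o'})=\varrho_o$, arrows the families $t=\{t_o\in(\varrho_o,\varsigma_o)\}$ with $r_{oo'}(t_{o'})=t_o$, and fibrewise operations. A DR-category is a symmetric tensor $C^*$-category with simple unit, conjugates (for every object $\rho$ there are an object $\overline\rho$ and $R\in(\iota,\overline\rho\rho)$, $\overline R\in(\iota,\rho\overline\rho)$ with $(\overline R^*\otimes1_\rho)\circ(1_\rho\otimes R)=1_\rho$, $(R^*\otimes1_{\overline\rho})\circ(1_{\overline\rho}\otimes\overline R)=1_{\overline\rho}$), direct sums and subobjects. A DR-presheaf is a symmetric tensor presheaf with simple units such that $\widetilde{\mathfrak{T}}$ is a DR-category. Associated presheaf bundle ${}_\beta\mathfrak{T}$. For $\varrho,\varsigma\in\mathrm{obj}\,\widetilde{\mathfrak{T}}$ let ${}_\phi(\varrho_a,\varsigma_a)$ be the space of all $t_a$, where $\{t_o\in(\varrho_o,\varsigma_o)\}_{o\ge a}$ satisfies $r_{oo'}(t_{o'})=t_o$ for $a\le o\le o'$ (evaluations at $a$ of arrows of the section category of the restriction of $\mathfrak{T}$ to $\{o\in K:o\ge a\}$). The category ${}_\beta T_a$ has objects $\varrho^a:=(\varrho,a)$, $\varrho\in\mathrm{obj}\,\widetilde{\mathfrak{T}}$,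 and arrows ${}_\beta(\varrho^a,\varsigma^a):={}_\phi(\varrho_a,\varsigma_a)$. The functors ${}_\beta r_{aa'}:{}_\beta T_{a'}\to{}_\beta T_a$, $a\le a'$, send $\varrho^{a'}$ to $\varrho^a$ and $f$ to $r_{aa'}(f)$. With $\varrho^a\varsigma^a:=(\varrho\varsigma)^a$ and the tensor product and symmetry of arrows of $T_a$, ${}_\beta\mathfrak{T}$ is a symmetric tensor presheaf bundle. ${}_\beta\widehat\varrho$ is its sub-presheaf bundle whose fibre at $o$ is the full subcategory of ${}_\beta T_o$ with objects the tensor powers of $\varrho^o$ (including the 0-th power). $G_\varrho$ and $\chi_\varrho$. For a compact group $G\subseteq\mathbb{U}(d)$, $\widehat\pi_G$ is the symmetric tensor $C^*$-category with objects the tensor powers $\pi_G^r$, $r=0,1,\dots$, of the defining representation on $\mathbb{C}^d$, arrows the intertwiners and flip symmetry. Any $u\in NG$ defines the symmetric tensor automorphism $\widehat u(t):=u^{\otimes s}\circ t\circ(u^{\otimes r})^*$, $t\in(\pi_G^r,\pi_G^s)$, depending only on $uG\in QG$; this gives an injective morphism $QG\to\mathbf{aut}\,\widehat\pi_G$. There is a symmetric tensor embedding $I:{}_\beta T_a\to\mathbf{Hilb}$ (the category of Hilbert spaces and bounded operators, with flip symmetry) whose image is a full subcategory of the dual of a compact group. With $H_\varrho:=I(\varrho^a)\simeq\mathbb{C}^d$, $G_\varrho\subseteq\mathbb{U}(d)$ is the compact Lie group image of that group under its representation on $H_\varrho$, and $I$ restricts to a symmetric tensor isomorphism of the fibre of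 ${}_\beta\widehat\varrho$ at $a$ with $\widehat\pi_{G_\varrho}$. For $\gamma=(b_n,\dots,b_1)\in K(a)$ let $Z_\gamma={}_\beta r_{\partial_0b_n,|b_n|}\circ{}_\beta r_{|b_n|,\partial_1b_n}\circ\cdots\circ{}_\beta r_{\partial_0b_1,|b_1|}\circ{}_\beta r_{|b_1|,\partial_1b_1}$ (where ${}_\beta r_{o'o}:={}_\beta r_{oo'}^{-1}$ for $o\le o'$), a symmetric tensor automorphism of ${}_\beta T_a$ with $Z_\gamma(\varrho^a)=\varrho^a$. There is a unitary tensor natural transformation $u(\gamma)$ from $I$ to $I\circ Z_\gamma$; its component at $\varrho^a$ is a unitary $u_\varrho(\gamma)\in NG_\varrho$, so that $I(Z_\gamma(f))=\widehat u_\varrho(\gamma)(I(f))$ for all arrows $f$ between tensor powers of $\varrho^a$. The holonomy of $\varrho$ is $\chi_\varrho([\gamma]):=q(u_\varrho(\gamma))$. The cochain. Fix a path frame, i.e. paths $\gamma_{ao}:o\to a$ for all $o\in K$. Then $\mathbf{u}_\varrho(b):=u_\varrho(\gamma_{a\partial_0b}*b*\gamma_{a\partial_1b}^{-1})$, $b\in\Sigma_1(K)$.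
   Formalization: Pairs (v,g) are identified when their cocycles are cohomologous via w with w(a)v(a)=v'(a): for K a point there is one lift but many pairs. That r_{aa'} maps the arrow spaces φ at a' into those at a, asserted in the context but not automatic, is a hypothesis. *)

(* Defs.v *)
From HB Require Import structures.
From Stdlib Require Import Relation_Operators.
From mathcomp Require Import all_boot all_order all_algebra.
From mathcomp Require Import all_classical all_reals all_analysis.
From mathcomp Require Import complex mxtens.

Set Implicit Arguments.
Unset Strict Implicit.
Unset Printing Implicit Defensive.

Import Order.TTheory GRing.Theory Num.Theory.
Import numFieldNormedType.Exports.
Local Open Scope classical_set_scope.
Local Open Scope ring_scope.
Local Open Scope sesquilinear_scope.
Local Open Scope quotient_scope.
Section QuotientGroup.
Variable N : groupType.

Record normalSubgroup := NormalSubgroup {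
  nsub :> N -> Prop;
  nsub1 : nsub 1%g;
  nsubM : forall x y, nsub x -> nsub y -> nsub (x * y)%g;
  nsubV : forall x, nsub x -> nsub (x^-1)%g;
  nsubJ : forall x y, nsub x -> nsub (y^-1 * x * y)%g }.

Variable H : normalSubgroup.

Definition coset_rel (x y : N) : bool := `[< H (x^-1 * y)%g >].

Lemma coset_rel_equiv : equiv_class_of coset_rel.
Proof.
split=> [x|x y|y x z].
- by apply/asboolP; rewrite mulVg; exact: nsub1.
- by apply/asboolP/asboolP => /nsubV; rewrite invgM invgK.
- move=> /asboolP h1 /asboolP h2; apply/asboolP.
  by have := nsubM h1 h2; rewrite mulgA -(mulgA x^-1%g) mulgV mulg1.
Qed.

Canonical coset_equiv := EquivRelPack coset_rel_equiv.

Definition quotientGroup := {eq_quot coset_equiv}.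
HB.instance Definition _ := Choice.on quotientGroup.
HB.instance Definition _ := EqQuotient.on quotientGroup.

Definition qproj (x : N) : quotientGroup := \pi x.

Lemma qprojP x y : qproj x = qproj y <-> H (x^-1 * y)%g.
Proof.
split=> [/eqmodP /asboolP //|h].
by apply/eqmodP/asboolP.
Qed.

Definition qone : quotientGroup := qproj 1%g.
Definition qmul (x y : quotientGroup) : quotientGroup :=
  qproj (repr x * repr y)%g.
Definition qinv (x : quotientGroup) : quotientGroup := qproj (repr x)^-1%g.

Lemma qproj_repr (x : quotientGroup) : qproj (repr x) = x.
Proof. exact: reprK. Qed.

Lemma qproj_mul x y : qmul (qproj x) (qproj y) = qproj (x * y)%g.
Proof.
apply/qprojP.
have /qprojP hx := qproj_repr (qproj x); have /qprojP hy := qproj_repr (qproj y).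
set x' := repr _ in hx *; set y' := repr _ in hy *.
have := nsubM hy (nsubJ y hx).
by rewrite invgM !mulgA mulgK.
Qed.

Lemma qproj_inv x : qinv (qproj x) = qproj x^-1%g.
Proof.
apply/qprojP; have /qprojP := qproj_repr (qproj x); set x' := repr _ => hx.
have := nsubJ x^-1%g (nsubV hx).
by rewrite invgM !invgK !mulgA mulgV mul1g.
Qed.

Lemma qmulA : associative qmul.
Proof.
move=> x y z; rewrite -(qproj_repr x) -(qproj_repr y) -(qproj_repr z).
by rewrite !qproj_mul mulgA.
Qed.
Lemma qmul1 : left_id qone qmul.
Proof. by move=> x; rewrite -(qproj_repr x) qproj_mul mul1g. Qed.
Lemma qmul1r : right_id qone qmul.
Proof. by move=> x; rewrite -(qproj_repr x) qproj_mul mulg1. Qed.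
Lemma qmulV : left_inverse qone qinv qmul.
Proof. by move=> x; rewrite -(qproj_repr x) qproj_inv qproj_mul mulVg. Qed.
Lemma qmulVr : right_inverse qone qinv qmul.
Proof. by move=> x; rewrite -(qproj_repr x) qproj_inv qproj_mul mulgV. Qed.

HB.instance Definition _ :=
  isGroup.Build quotientGroup qmulA qmul1 qmul1r qmulV qmulVr.

Lemma qproj_morph : {morph qproj : x y / (x * y)%g >-> (x * y)%g}.
Proof. by move=> x y; rewrite -qproj_mul. Qed.

HB.instance Definition _ :=
  isMultiplicative.Build N quotientGroup qproj qproj_morph.

End QuotientGroup.

HB.mixin Record isTopologicalGroup G of Group G & Topological G := {
  mulg_continuous : continuous (fun xy : G * G => (xy.1 * xy.2)%g);
  invg_continuous : continuous (fun x : G => (x^-1)%g) }.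

#[short(type="topologicalGroupType")]
HB.structure Definition TopologicalGroup :=
  {G of Group G & Topological G & isTopologicalGroup G}.

Section UnitaryGroups.
Variables (C : numClosedFieldType) (d : nat).

Record compactUnitaryGroup := CompactUnitaryGroup {
  gset :> 'M[C]_d -> Prop;
  gset_unitary : forall M, gset M -> M \is unitarymx;
  gset1 : gset 1%:M;
  gsetM : forall M N, gset M -> gset N -> gset (M *m N);
  gsetV : forall M, gset M -> gset (M ^t*);
  gset_compact : compact [set M | gset M] }.

Variable G : compactUnitaryGroup.

Definition normalizes (U : 'M[C]_d) : bool :=
  (U \is unitarymx) &&
  `[< [set U *m M *m U ^t* | M in [set M | G M]] = [set M | G M] >].

Definition normalizer := {U : 'M[C]_d | normalizes U}.
HB.instance Definition _ := Choice.on normalizer.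

Lemma unitarymxl (U : 'M[C]_d) : U \is unitarymx -> U *m U ^t* = 1%:M.
Proof. by move/unitarymxP. Qed.

Lemma unitarymxr (U : 'M[C]_d) : U \is unitarymx -> U ^t* *m U = 1%:M.
Proof. by move/unitarymxP/mulmx1C. Qed.

Lemma adjmxK m n (U : 'M[C]_(m, n)) : (U ^t*) ^t* = U.
Proof. by apply/matrixP => i j; rewrite !mxE conjCK. Qed.

Lemma adjmxM m n p (U : 'M[C]_(m, n)) (V : 'M[C]_(n, p)) :
  (U *m V) ^t* = V ^t* *m U ^t*.
Proof. by rewrite trmx_mul map_mxM. Qed.

Lemma adjmx1 n : (1%:M : 'M[C]_n) ^t* = 1%:M.
Proof. by rewrite trmx1 map_mx1. Qed.

Lemma normalizesP U : reflect
  (U \is unitarymx /\ forall M, G M <-> G (U *m M *m U ^t*)) (normalizes U).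
Proof.
have conjK (V M : 'M[C]_d) : V \is unitarymx ->
    V ^t* *m (V *m M *m V ^t*) *m V = M.
  move=> Vu; rewrite !mulmxA unitarymxr // mul1mx -mulmxA unitarymxr //.
  by rewrite mulmx1.
apply: (iffP andP) => [[Uu]|[Uu h]].
  move/asboolP/seteqP => [h1 h2]; split=> // M; split=> hM.
    by apply: (h1 (U *m M *m U ^t*)); exists M.
  have [N hN /(congr1 (fun X => U ^t* *m X *m U))] := h2 _ hM.
  by rewrite !conjK // => <-.
have conjK' (M : 'M[C]_d) : U *m (U ^t* *m M *m U) *m U ^t* = M.
  by have := @conjK (U ^t*) M; rewrite adjmxK; apply; rewrite trmxC_unitary.
split=> //; apply/asboolP/seteqP; split=> M /= => [[N hN <-]|hM].
  exact: (proj1 (h N) hN).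
exists (U ^t* *m M *m U); last exact: conjK'.
by apply: (proj2 (h _)); rewrite conjK'.
Qed.

Lemma normalizes1 : normalizes 1%:M.
Proof.
apply/normalizesP; split; first by apply/unitarymxP; rewrite adjmx1 mulmx1.
by move=> M; rewrite adjmx1 mulmx1 mul1mx.
Qed.

Lemma normalizesM U V : normalizes U -> normalizes V -> normalizes (U *m V).
Proof.
move=> /normalizesP[Uu hU] /normalizesP[Vu hV]; apply/normalizesP.
split; first exact: mul_unitarymx.
by move=> M; rewrite adjmxM (hV M) (hU _) !mulmxA.
Qed.

Lemma normalizesV U : normalizes U -> normalizes (U ^t*).
Proof.
move=> /normalizesP[Uu hU]; apply/normalizesP.
split; first by rewrite trmxC_unitary.
move=> M; rewrite adjmxK (hU (_ *m U)) !mulmxA unitarymxl // mul1mx.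
by rewrite -mulmxA unitarymxl // mulmx1.
Qed.

Definition nmul (U V : normalizer) : normalizer :=
  Sub (val U *m val V) (normalizesM (valP U) (valP V)).
Definition none : normalizer := Sub 1%:M normalizes1.
Definition ninv (U : normalizer) : normalizer :=
  Sub ((val U) ^t*) (normalizesV (valP U)).

Lemma normalizer_unitary (U : normalizer) : val U \is unitarymx.
Proof. by case/normalizesP: (valP U). Qed.

Lemma nmulA : associative nmul.
Proof. by move=> U V W; apply: val_inj; rewrite /= mulmxA. Qed.
Lemma nmul1 : left_id none nmul.
Proof. by move=> U; apply: val_inj; rewrite /= mul1mx. Qed.
Lemma nmul1r : right_id none nmul.
Proof. by move=> U; apply: val_inj; rewrite /= mulmx1. Qed.
Lemma nmulV : left_inverse none ninv nmul.
Proof.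
by move=> U; apply: val_inj; rewrite /= unitarymxr // normalizer_unitary.
Qed.
Lemma nmulVr : right_inverse none ninv nmul.
Proof.
by move=> U; apply: val_inj; rewrite /= unitarymxl // normalizer_unitary.
Qed.

HB.instance Definition _ :=
  isGroup.Build normalizer nmulA nmul1 nmul1r nmulV nmulVr.

Definition in_group (U : normalizer) : Prop := G (val U).

Definition group_normal : normalSubgroup normalizer.
Proof.
exists in_group.
- exact: gset1.
- by move=> U V; exact: gsetM.
- by move=> U; exact: gsetV.
- move=> U V hU; have /normalizesP[_ h] := valP (V^-1)%g.
  by have /h := hU; rewrite /in_group /= adjmxK.
Defined.

End UnitaryGroups.

Notation outer G := (quotientGroup (group_normal G)).
Notation outer_proj G := (@qproj (normalizer G) (group_normal G)).

Section Simplices.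
Variables (disp : Order.disp_t) (K : porderType disp).
Implicit Types o : K.

Definition simplex1 := {b : K * K * K | (b.1.1 <= b.2) && (b.1.2 <= b.2)}%O.
HB.instance Definition _ := Choice.on simplex1.

Implicit Types b : simplex1.

Definition d0 b : K := (val b).1.1.
Definition d1 b : K := (val b).1.2.
Definition supp b : K := (val b).2.

Lemma d0_le b : (d0 b <= supp b)%O. Proof. by case/andP: (valP b). Qed.
Lemma d1_le b : (d1 b <= supp b)%O. Proof. by case/andP: (valP b). Qed.

Definition mksimplex o0 o1 x (h0 : (o0 <= x)%O) (h1 : (o1 <= x)%O) : simplex1 :=
  Sub (o0, o1, x) (introT andP (conj h0 h1)).

Definition srev b : simplex1 := mksimplex (d1_le b) (d0_le b).

Record simplex2 := Simplex2 {
  f0 : simplex1; f1 : simplex1; f2 : simplex1; supp2 : K;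
  f0_le : (supp f0 <= supp2)%O;
  f1_le : (supp f1 <= supp2)%O;
  f2_le : (supp f2 <= supp2)%O;
  f001 : d0 f0 = d0 f1;
  f102 : d1 f0 = d0 f2;
  f112 : d1 f1 = d1 f2 }.

(* A sequence (b_n, ..., b_1) is listed with b_n first, so that composition of
   paths is concatenation, the right factor being run first. *)
Fixpoint chain (o o' : K) (s : seq simplex1) : bool :=
  if s is b :: s' then (d0 b == o') && chain o (d1 b) s' else o == o'.

Definition is_path o o' (s : seq simplex1) : bool := (s != [::]) && chain o o' s.

Definition kpath o o' := {s : seq simplex1 | is_path o o' s}.
HB.instance Definition _ o o' := Choice.on (kpath o o').

Definition pathwise_connected : Prop :=
  forall o o', exists s, is_path o o' s.

Lemma chain_cat o o' o'' s t :
  chain o' o'' s -> chain o o' t -> chain o o'' (s ++ t).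
Proof.
elim: s o'' => [|b s IH] o'' /=; first by move/eqP <-.
by case/andP => /eqP <- h1 h2; rewrite eqxx /=; exact: IH.
Qed.

Lemma chain_catE o o'' s t :
  chain o o'' (s ++ t) -> exists2 o', chain o' o'' s & chain o o' t.
Proof.
elim: s o'' => [|b s IH] o'' /=; first by exists o''; rewrite /= ?eqxx.
case/andP => e0 h; have [x h1 h2] := IH _ h; by exists x; rewrite //= e0.
Qed.

Lemma path_comp_subproof o o' o'' (p : kpath o' o'') (q : kpath o o') :
  is_path o o'' (val p ++ val q).
Proof.
case: p q => [[|b s] //= /andP[_ h]] [t /= /andP[_ h']].
by rewrite /is_path /=; case/andP: h => -> /= h; exact: chain_cat h h'.
Qed.

Definition path_comp o o' o'' (p : kpath o' o'') (q : kpath o o') : kpath o o'' :=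
  Sub (val p ++ val q) (path_comp_subproof p q).

Lemma path1_subproof b : is_path (d1 b) (d0 b) [:: b].
Proof. by rewrite /is_path /= !eqxx. Qed.

Definition path1 b : kpath (d1 b) (d0 b) := Sub [:: b] (path1_subproof b).

Lemma chain_rev o o' s : chain o o' s -> chain o' o (rev (map srev s)).
Proof.
elim: s o' => [|b s IH] o' /=; first by rewrite eq_sym.
case/andP => /eqP <- h; have {}h := IH _ h; rewrite rev_cons -cats1.
by apply: chain_cat h _; rewrite /= /d0 /d1 /= !eqxx.
Qed.

Lemma path_rev_subproof o o' (p : kpath o o') :
  is_path o' o (rev (map srev (val p))).
Proof.
case: p => s /= /andP[hs h]; rewrite /is_path chain_rev // andbT.
by rewrite -size_eq0 size_rev size_map size_eq0.
Qed.

Definition path_rev o o' (p : kpath o o') : kpath o' o :=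
  Sub (rev (map srev (val p))) (path_rev_subproof p).

Inductive elementary : seq simplex1 -> seq simplex1 -> Prop :=
| Elementary s t (c : simplex2) :
    elementary (s ++ f1 c :: t) (s ++ f0 c :: f2 c :: t).

Definition seq_homotopic := clos_refl_sym_trans (seq simplex1) elementary.

Definition homotopic o o' (p q : kpath o o') : Prop :=
  seq_homotopic (val p) (val q).

Lemma seq_homotopic_refl s : seq_homotopic s s.
Proof. exact: rst_refl. Qed.
Lemma seq_homotopic_sym s t : seq_homotopic s t -> seq_homotopic t s.
Proof. exact: rst_sym. Qed.
Lemma seq_homotopic_trans t s u :
  seq_homotopic s t -> seq_homotopic t u -> seq_homotopic s u.
Proof. exact: rst_trans. Qed.

Lemma elementary_homotopic s t (c : simplex2) :
  seq_homotopic (s ++ f1 c :: t) (s ++ f0 c :: f2 c :: t).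
Proof. exact/rst_step/Elementary. Qed.

Lemma seq_homotopic_ctx u v s t :
  seq_homotopic s t -> seq_homotopic (u ++ s ++ v) (u ++ t ++ v).
Proof.
elim=> [x y [x' y' c]|x|x y _|x y z _ h1 _ h2].
- have := elementary_homotopic (u ++ x') (y' ++ v) c.
  by rewrite -!catA !cat_cons.
- exact: seq_homotopic_refl.
- exact: seq_homotopic_sym.
- exact: seq_homotopic_trans h1 h2.
Qed.

Lemma seq_homotopic_cat s s' t t' :
  seq_homotopic s s' -> seq_homotopic t t' -> seq_homotopic (s ++ t) (s' ++ t').
Proof.
move=> h h'; apply: (@seq_homotopic_trans (s' ++ t)).
  exact: (seq_homotopic_ctx [::] t h).
by have := seq_homotopic_ctx s' [::] h'; rewrite !cats0.
Qed.

Lemma elementary_chain o o' s t :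
  elementary s t -> chain o o' s = chain o o' t.
Proof.
case=> {}s {}t c; elim: s o' => [|b s IH] o' /=; last by rewrite IH.
by rewrite f001 f102 f112 eqxx.
Qed.

Lemma homotopic_chain o o' s t :
  seq_homotopic s t -> chain o o' s = chain o o' t.
Proof.
elim=> // [x y|x y z _ -> _ ->//]; exact: elementary_chain.
Qed.

Definition degen o : simplex1 := mksimplex (lexx o) (lexx o).

Lemma degen_l b : seq_homotopic [:: b] [:: degen (d0 b); b].
Proof.
pose c := @Simplex2 (degen (d0 b)) b b (supp b) (d0_le b) (lexx _) (lexx _)
  erefl erefl erefl.
exact: (elementary_homotopic [::] [::] c).
Qed.

Lemma degen_r b : seq_homotopic [:: b] [:: b; degen (d1 b)].
Proof.
pose c := @Simplex2 b b (degen (d1 b)) (supp b) (lexx _) (lexx _) (d1_le b)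
  erefl erefl erefl.
exact: (elementary_homotopic [::] [::] c).
Qed.

Lemma loop_degen o x (h : (o <= x)%O) :
  seq_homotopic [:: degen o] [:: mksimplex h h].
Proof.
set f := mksimplex h h.
pose c1 := @Simplex2 f (degen o) (degen o) x (lexx _) h h erefl erefl erefl.
pose c2 := @Simplex2 f f (degen o) x (lexx _) (lexx _) h erefl erefl erefl.
apply: (@seq_homotopic_trans [:: f; degen o]).
  exact: (elementary_homotopic [::] [::] c1).
exact/seq_homotopic_sym/(elementary_homotopic [::] [::] c2).
Qed.

Lemma srevV b : seq_homotopic [:: srev b; b] [:: degen (d1 b)].
Proof.
apply: seq_homotopic_sym; apply: seq_homotopic_trans (loop_degen (d1_le b)) _.
pose c := @Simplex2 (srev b) (mksimplex (d1_le b) (d1_le b)) b (supp b)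
  (lexx _) (lexx _) (lexx _) erefl erefl erefl.
exact: (elementary_homotopic [::] [::] c).
Qed.

Lemma srevVr b : seq_homotopic [:: b; srev b] [:: degen (d0 b)].
Proof.
apply: seq_homotopic_sym; apply: seq_homotopic_trans (loop_degen (d0_le b)) _.
pose c := @Simplex2 b (mksimplex (d0_le b) (d0_le b)) (srev b) (supp b)
  (lexx _) (lexx _) (lexx _) erefl erefl erefl.
exact: (elementary_homotopic [::] [::] c).
Qed.

Lemma path_degen_l o o' s : is_path o o' s -> seq_homotopic (degen o' :: s) s.
Proof.
case: s => [//|b s] /= /andP[_ /andP[/eqP <- _]].
exact/seq_homotopic_sym/(seq_homotopic_cat (degen_l b) (seq_homotopic_refl s)).
Qed.

Lemma path_degen_r o o' s : is_path o o' s -> seq_homotopic (s ++ [:: degen o]) s.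
Proof.
case/lastP: s => [//|s b]; rewrite /is_path -!cats1 => /andP[_].
case/chain_catE => x _ /= /andP[_ /eqP ->].
rewrite -catA; apply: seq_homotopic_cat; first exact: seq_homotopic_refl.
exact/seq_homotopic_sym/degen_r.
Qed.

Lemma path_revV o o' s : is_path o o' s ->
  seq_homotopic (rev (map srev s) ++ s) [:: degen o].
Proof.
elim: s o' => [//|b s IH] o' /andP[_ /= /andP[_ h]].
rewrite rev_cons -cats1 -catA /=.
case: s => [|b' s] in IH h *.
  by move/eqP: h => -> /=; exact: srevV.
have h' : is_path o (d1 b) (b' :: s) by [].
apply: seq_homotopic_trans (IH _ h').
apply: seq_homotopic_cat; first exact: seq_homotopic_refl.
apply: (@seq_homotopic_trans (degen (d1 b) :: b' :: s)).
  exact: (seq_homotopic_cat (srevV b) (seq_homotopic_refl _)).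
exact: path_degen_l h'.
Qed.

Lemma map_srevK : involutive (map srev).
Proof.
move=> s; rewrite -map_comp map_id_in // => b _.
by apply: val_inj; case: b => [[[x y] z] h].
Qed.

Lemma elementary_rev s t : elementary s t ->
  seq_homotopic (rev (map srev s)) (rev (map srev t)).
Proof.
case=> {}s {}t c; rewrite !map_cat /= !rev_cat !rev_cons -!cats1 -!catA /=.
pose c' := @Simplex2 (srev (f2 c)) (srev (f1 c)) (srev (f0 c)) (supp2 c)
  (f2_le c) (f1_le c) (f0_le c) (esym (f112 c)) (esym (f102 c)) (esym (f001 c)).
exact: (elementary_homotopic _ _ c').
Qed.

Lemma seq_homotopic_rev s t : seq_homotopic s t ->
  seq_homotopic (rev (map srev s)) (rev (map srev t)).
Proof.
elim=> [x y|x|x y _|x y z _ h1 _ h2].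
- exact: elementary_rev.
- exact: seq_homotopic_refl.
- exact: seq_homotopic_sym.
- exact: seq_homotopic_trans h1 h2.
Qed.

End Simplices.

Section FundamentalGroup.
Variables (disp : Order.disp_t) (K : porderType disp) (a : K).

Notation loop := (kpath a a).

Definition homotopicb (p q : loop) : bool := `[< homotopic p q >].

Lemma homotopicb_equiv : equiv_class_of homotopicb.
Proof.
split=> [p|p q|q p r].
- exact/asboolP/seq_homotopic_refl.
- by apply/asboolP/asboolP; exact: seq_homotopic_sym.
- move=> /asboolP h1 /asboolP h2; apply/asboolP.
  exact: seq_homotopic_trans h1 h2.
Qed.

Canonical homotopic_equiv := EquivRelPack homotopicb_equiv.

Definition pi1 := {eq_quot homotopic_equiv}.
HB.instance Definition _ := Choice.on pi1.
HB.instance Definition _ := EqQuotient.on pi1.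

Definition pclass (p : loop) : pi1 := \pi p.

Lemma pclassP p q : pclass p = pclass q <-> homotopic p q.
Proof. by split=> [/eqmodP /asboolP //|h]; apply/eqmodP/asboolP. Qed.

Definition pi1_one : pi1 := pclass (path1 (degen a)).
Definition pi1_mul (x y : pi1) : pi1 := pclass (path_comp (repr x) (repr y)).
Definition pi1_inv (x : pi1) : pi1 := pclass (path_rev (repr x)).

Lemma pclass_repr x : pclass (repr x) = x.
Proof. exact: reprK. Qed.

Lemma pclass_comp p q : pi1_mul (pclass p) (pclass q) = pclass (path_comp p q).
Proof.
apply/pclassP; apply: seq_homotopic_cat; exact/pclassP/pclass_repr.
Qed.

Lemma pclass_rev p : pi1_inv (pclass p) = pclass (path_rev p).
Proof. apply/pclassP; apply: seq_homotopic_rev; exact/pclassP/pclass_repr. Qed.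

Lemma pi1_mulA : associative pi1_mul.
Proof.
move=> x y z; rewrite -(pclass_repr x) -(pclass_repr y) -(pclass_repr z).
rewrite !pclass_comp; congr pclass; apply: val_inj; exact: catA.
Qed.

Lemma pi1_mul1 : left_id pi1_one pi1_mul.
Proof.
move=> x; rewrite -(pclass_repr x) pclass_comp; apply/pclassP.
exact: path_degen_l (valP _).
Qed.

Lemma pi1_mul1r : right_id pi1_one pi1_mul.
Proof.
move=> x; rewrite -(pclass_repr x) pclass_comp; apply/pclassP.
exact: path_degen_r (valP _).
Qed.

Lemma pi1_mulV : left_inverse pi1_one pi1_inv pi1_mul.
Proof.
move=> x; rewrite -(pclass_repr x) pclass_rev pclass_comp; apply/pclassP.
exact: path_revV (valP _).
Qed.

Lemma pi1_mulVr : right_inverse pi1_one pi1_inv pi1_mul.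
Proof.
move=> x; rewrite -(pclass_repr x) pclass_rev pclass_comp; apply/pclassP.
have := path_revV (valP (path_rev (repr x))).
by rewrite /= map_rev map_srevK revK.
Qed.

HB.instance Definition _ :=
  isGroup.Build pi1 pi1_mulA pi1_mul1 pi1_mul1r pi1_mulV pi1_mulVr.

End FundamentalGroup.

Reserved Notation "g '\oc' f" (at level 40, left associativity).

Section Categories.
Variable C : numClosedFieldType.

Record starStructure (obj : Type) (hom : obj -> obj -> lmodType C) :=
  StarStructure {
  str_idm : forall a, hom a a;
  str_comp : forall a b c, hom b c -> hom a b -> hom a c;
  str_adj : forall a b, hom a b -> hom b a;
  str_compA : forall a b c d (h : hom c d) (g : hom b c) (f : hom a b),
    str_comp h (str_comp g f) = str_comp (str_comp h g) f;
  str_comp1m : forall a b (f : hom a b), str_comp (str_idm b) f = f;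
  str_compm1 : forall a b (f : hom a b), str_comp f (str_idm a) = f;
  str_comp_linl : forall a b c (f : hom a b) k (g g' : hom b c),
    str_comp (k *: g + g') f = k *: str_comp g f + str_comp g' f;
  str_comp_linr : forall a b c (g : hom b c) k (f f' : hom a b),
    str_comp g (k *: f + f') = k *: str_comp g f + str_comp g f';
  str_adj_lin : forall a b k (f f' : hom a b),
    str_adj (k *: f + f') = k^* *: str_adj f + str_adj f';
  str_adjK : forall a b (f : hom a b), str_adj (str_adj f) = f;
  str_adjM : forall a b c (g : hom b c) (f : hom a b),
    str_adj (str_comp g f) = str_comp (str_adj f) (str_adj g) }.

Record starCat := StarCat {
  obj : Type;
  hom : obj -> obj -> lmodType C;
  star_str : starStructure hom }.

Definition idm (T : starCat) (a : obj T) : hom a a := str_idm (star_str T) a.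
Definition hcomp (T : starCat) (a b c : obj T) (g : hom b c) (f : hom a b) :
  hom a c := str_comp (star_str T) g f.
Definition adj (T : starCat) (a b : obj T) (f : hom a b) : hom b a :=
  str_adj (star_str T) f.

(* The last axiom is the positivity of f^* f in the C*-algebra (a, a). *)
Record cstarCat := CstarCat {
  cobj : Type;
  chom : cobj -> cobj -> completeNormedModType C;
  cstar_str : starStructure (fun a b => chom a b : lmodType C);
  norm_comp : forall a b c (g : chom b c) (f : chom a b),
    `|str_comp cstar_str g f| <= `|g| * `|f|;
  norm_cstar : forall a b (f : chom a b),
    `|str_comp cstar_str (str_adj cstar_str f) f| = `|f| ^+ 2;
  cstar_pos : forall a b (f : chom a b), exists h : chom a a,
    str_comp cstar_str (str_adj cstar_str f) f =
    str_comp cstar_str (str_adj cstar_str h) h }.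

Coercion starCat_of_cstarCat (T : cstarCat) : starCat := StarCat (cstar_str T).

Section StarCatTheory.
Variable T : starCat.
Implicit Types a b c d : obj T.
Local Notation "g '\oc' f" := (hcomp g f).

Lemma compA a b c d (h : hom c d) (g : hom b c) (f : hom a b) :
  h \oc (g \oc f) = (h \oc g) \oc f.
Proof. exact: str_compA. Qed.
Lemma comp1m a b (f : hom a b) : idm b \oc f = f.
Proof. exact: str_comp1m. Qed.
Lemma compm1 a b (f : hom a b) : f \oc idm a = f.
Proof. exact: str_compm1. Qed.
Lemma adjK a b (f : hom a b) : adj (adj f) = f.
Proof. exact: str_adjK. Qed.
Lemma adjM a b c (g : hom b c) (f : hom a b) :
  adj (g \oc f) = adj f \oc adj g.
Proof. exact: str_adjM. Qed.
Lemma comp_linl a b c (f : hom a b) k (g g' : hom b c) :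
  (k *: g + g') \oc f = k *: (g \oc f) + g' \oc f.
Proof. exact: str_comp_linl. Qed.
Lemma comp_linr a b c (g : hom b c) k (f f' : hom a b) :
  g \oc (k *: f + f') = k *: (g \oc f) + g \oc f'.
Proof. exact: str_comp_linr. Qed.
Lemma adj_lin a b k (f f' : hom a b) :
  adj (k *: f + f') = k^* *: adj f + adj f'.
Proof. exact: str_adj_lin. Qed.
Lemma adj1 a : adj (idm a) = idm a.
Proof. by rewrite -[LHS]compm1 -{2}(adjK (idm a)) -adjM compm1 adjK. Qed.

(* The arrow underlying an equality of objects: the identity arrow, seen in
   (a, b).  It is used to state strict equalities between arrows whose sources
   and targets are equal, but not convertible, objects. *)
Definition idto a b (e : a = b) : hom a b :=
  match e in _ = b' return hom a b' with erefl => idm a end.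

Lemma idto_id a (e : a = a) : idto e = idm a.
Proof. by rewrite (Prop_irrelevance e erefl). Qed.
Lemma idtoM a b c (e : b = c) (e' : a = b) (e'' : a = c) :
  idto e \oc idto e' = idto e''.
Proof. by case: _ / e e'' => e''; rewrite comp1m (Prop_irrelevance e' e''). Qed.
Lemma idto_adj a b (e : a = b) (e' : b = a) : adj (idto e) = idto e'.
Proof. by case: _ / e e' => e'; rewrite adj1 idto_id. Qed.

Lemma idto_moveL a b c (e : b = c) (e' : c = b) (f : hom a b) (g : hom a c) :
  idto e \oc f = g <-> f = idto e' \oc g.
Proof.
by case: _ / e e' g => e' g; rewrite (idto_id e') /= !comp1m.
Qed.

End StarCatTheory.
End Categories.

Notation "g '\oc' f" := (hcomp g f).

Section Tensor.
Variable C : numClosedFieldType.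

(* Strict monoidal structures: the equalities of objects tobjA, tobj1l, tobj1r
   hold in obj T, and the associator and the unitors are identities. *)
Record symTensor (T : starCat C) := SymTensor {
  tobj : obj T -> obj T -> obj T;
  tunit : obj T;
  tobjA : forall a b c, tobj (tobj a b) c = tobj a (tobj b c);
  tobj1l : forall a, tobj tunit a = a;
  tobj1r : forall a, tobj a tunit = a;
  tens : forall a b a' b', hom a b -> hom a' b' -> hom (tobj a a') (tobj b b');
  symm : forall a b, hom (tobj a b) (tobj b a);
  tens_linl : forall a b a' b' k (f g : hom a b) (h : hom a' b'),
    tens (k *: f + g) h = k *: tens f h + tens g h;
  tens_linr : forall a b a' b' k (h : hom a b) (f g : hom a' b'),
    tens h (k *: f + g) = k *: tens h f + tens h g;
  tens1 : forall a b, tens (idm a) (idm b) = idm (tobj a b);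
  tensM : forall a b c a' b' c' (g : hom b c) (f : hom a b)
      (g' : hom b' c') (f' : hom a' b'),
    tens (g \oc f) (g' \oc f') = tens g g' \oc tens f f';
  tens_adj : forall a b a' b' (f : hom a b) (f' : hom a' b'),
    adj (tens f f') = tens (adj f) (adj f');
  tensA : forall a b a' b' a'' b'' (f : hom a b) (f' : hom a' b')
      (f'' : hom a'' b''),
    idto (tobjA b b' b'') \oc tens (tens f f') f'' =
    tens f (tens f' f'') \oc idto (tobjA a a' a'');
  tens1l : forall a b (f : hom a b),
    idto (tobj1l b) \oc tens (idm tunit) f = f \oc idto (tobj1l a);
  tens1r : forall a b (f : hom a b),
    idto (tobj1r b) \oc tens f (idm tunit) = f \oc idto (tobj1r a);
  sym_nat : forall a b a' b' (f : hom a b) (f' : hom a' b'),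
    symm b b' \oc tens f f' = tens f' f \oc symm a a';
  symK : forall a b, symm b a \oc symm a b = idm (tobj a b);
  sym_adj : forall a b, adj (symm a b) = symm b a;
  sym1 : forall a, symm a tunit = idto (esym (tobj1l a)) \oc idto (tobj1r a);
  sym_hex : forall a b c,
    symm (tobj a b) c =
    idto (tobjA c a b) \oc tens (symm a c) (idm b) \oc
    idto (esym (tobjA a c b)) \oc tens (idm a) (symm b c) \oc
    idto (tobjA a b c) }.

Section DR.
Variables (T : starCat C) (S : symTensor T).

Definition simple_unit : Prop :=
  forall f : hom (tunit S) (tunit S), exists! k : C, f = k *: idm (tunit S).

(* b is a conjugate of a, r and r' being R and its barred counterpart. *)
Definition conjugate (a b : obj T) (r : hom (tunit S) (tobj S b a))
    (r' : hom (tunit S) (tobj S a b)) : Prop :=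
  idto (tobj1l S a) \oc tens S (adj r') (idm a) \oc
    idto (esym (tobjA S a b a)) \oc tens S (idm a) r \oc
    idto (esym (tobj1r S a)) = idm a /\
  idto (tobj1l S b) \oc tens S (adj r) (idm b) \oc
    idto (esym (tobjA S b a b)) \oc tens S (idm b) r' \oc
    idto (esym (tobj1r S b)) = idm b.

Definition has_conjugates : Prop :=
  forall a : obj T, exists b r r', @conjugate a b r r'.

Definition has_direct_sums : Prop :=
  forall a b : obj T, exists c (v : hom a c) (w : hom b c),
    [/\ adj v \oc v = idm a, adj w \oc w = idm b &
        v \oc adj v + w \oc adj w = idm c].

Definition has_subobjects : Prop :=
  forall (a : obj T) (p : hom a a), adj p = p -> p \oc p = p -> p != 0 ->
  exists b (v : hom b a), adj v \oc v = idm b /\ v \oc adj v = p.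

Definition DR_category : Prop :=
  [/\ simple_unit, has_conjugates, has_direct_sums & has_subobjects].

End DR.

Section Functors.

Record starFunctor (T T' : starCat C) := StarFunctor {
  fobj :> obj T -> obj T';
  fhom : forall a b, hom a b -> hom (fobj a) (fobj b);
  fhom_lin : forall a b k (f g : hom a b),
    fhom (k *: f + g) = k *: fhom f + fhom g;
  fhom1 : forall a, fhom (idm a) = idm (fobj a);
  fhomM : forall a b c (g : hom b c) (f : hom a b),
    fhom (g \oc f) = fhom g \oc fhom f;
  fhom_adj : forall a b (f : hom a b), fhom (adj f) = adj (fhom f) }.

Record tensorFunctor T T' (S : symTensor T) (S' : symTensor T')
    (F : starFunctor T T') := TensorFunctor {
  ftobj : forall a b, F (tobj S a b) = tobj S' (F a) (F b);
  ftunit : F (tunit S) = tunit S';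
  fhom_tens : forall a b a' b' (f : hom a b) (f' : hom a' b'),
    idto (ftobj b b') \oc fhom F (tens S f f') =
    tens S' (fhom F f) (fhom F f') \oc idto (ftobj a a');
  fhom_sym : forall a b,
    idto (ftobj b a) \oc fhom F (symm S a b) =
    symm S' (F a) (F b) \oc idto (ftobj a b) }.

Lemma fhom_idto T T' (F : starFunctor T T') (a b : obj T) (e : a = b)
  (e' : F a = F b) : fhom F (idto e) = idto e'.
Proof. by case: _ / e e' => e'; rewrite fhom1 idto_id. Qed.

Lemma tens_idto T (S : symTensor T) (a b a' b' : obj T) (e : a = b)
    (e' : a' = b') (e'' : tobj S a a' = tobj S b b') :
  tens S (idto e) (idto e') = idto e''.
Proof. by case: _ / e e''; case: _ / e' => e''; rewrite tens1 idto_id. Qed.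

Lemma sym_idto T (S : symTensor T) (a b a' b' : obj T) (e : a = b)
    (e' : a' = b') (e1 : tobj S a' a = tobj S b' b)
    (e2 : tobj S b b' = tobj S a a') :
  idto e1 \oc symm S a a' \oc idto e2 = symm S b b'.
Proof.
by case: _ / e e1 e2; case: _ / e' => e1 e2; rewrite !idto_id comp1m compm1.
Qed.

End Functors.
End Tensor.

Section Cast.
Variables (C : numClosedFieldType) (T : starCat C).

Definition hcast (a a' b b' : obj T) (ea : a = a') (eb : b = b') (f : hom a b) :
  hom a' b' := idto eb \oc f \oc idto (esym ea).

Lemma cast_id a b (ea : a = a) (eb : b = b) (f : hom a b) : hcast ea eb f = f.
Proof. by rewrite /hcast !idto_id comp1m compm1. Qed.

Lemma cast_lin a a' b b' (ea : a = a') (eb : b = b') k (f g : hom a b) :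
  hcast ea eb (k *: f + g) = k *: hcast ea eb f + hcast ea eb g.
Proof. by rewrite /hcast comp_linr comp_linl. Qed.

Lemma cast_comp a a' b b' c c' (ea : a = a') (eb : b = b') (ec : c = c')
    (g : hom b c) (f : hom a b) :
  hcast ea ec (g \oc f) = hcast eb ec g \oc hcast ea eb f.
Proof. by case: _ / ea; case: _ / eb; case: _ / ec; rewrite !cast_id. Qed.

Lemma cast_idto a a' b b' (ea : a = a') (eb : b = b') (e : a = b)
    (e' : a' = b') : hcast ea eb (idto e) = idto e'.
Proof. by case: _ / ea e'; case: _ / eb => e'; rewrite cast_id (Prop_irrelevance e e'). Qed.

Lemma cast_idm a a' (ea ea' : a = a') : hcast ea ea' (idm a) = idm a'.
Proof. by rewrite (@cast_idto _ _ _ _ ea ea' erefl erefl). Qed.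

Lemma cast_adj a a' b b' (ea : a = a') (eb : b = b') (f : hom a b) :
  hcast eb ea (adj f) = adj (hcast ea eb f).
Proof. by case: _ / ea; case: _ / eb; rewrite !cast_id. Qed.

Lemma castK a a' b b' (ea : a = a') (eb : b = b') (ea' : a' = a) (eb' : b' = b)
  (f : hom a b) : hcast ea' eb' (hcast ea eb f) = f.
Proof. by case: _ / ea ea'; case: _ / eb eb' => eb' ea'; rewrite !cast_id. Qed.

Lemma cast_cast a a' b b' a'' b'' (ea : a = a') (eb : b = b') (ea' : a' = a'')
    (eb' : b' = b'') (ea'' : a = a'') (eb'' : b = b'') (f : hom a b) :
  hcast ea' eb' (hcast ea eb f) = hcast ea'' eb'' f.
Proof.
by case: _ / ea ea' ea''; case: _ / eb eb' eb'' => eb' eb'' ea' ea'';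
  rewrite cast_id (Prop_irrelevance ea'' ea') (Prop_irrelevance eb'' eb').
Qed.

Lemma cast_move a a' b b' (ea : a = a') (eb : b = b') (f : hom a b)
    (g : hom a' b') : idto eb \oc f = g \oc idto ea -> hcast ea eb f = g.
Proof.
by case: _ / ea g; case: _ / eb => g; rewrite cast_id comp1m compm1.
Qed.

Lemma cast_tens (S : symTensor T) a a' b b' c c' d d' (ea : a = a') (eb : b = b')
    (ec : c = c') (ed : d = d') (eac : tobj S a c = tobj S a' c')
    (ebd : tobj S b d = tobj S b' d') (f : hom a b) (g : hom c d) :
  hcast eac ebd (tens S f g) = tens S (hcast ea eb f) (hcast ec ed g).
Proof.
case: _ / ea eac; case: _ / eb ebd; case: _ / ec; case: _ / ed => ebd eac.
by rewrite !cast_id.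
Qed.

Lemma cast_sym (S : symTensor T) a a' b b' (ea : a = a') (eb : b = b')
    (e : tobj S a b = tobj S a' b') (e' : tobj S b a = tobj S b' a') :
  hcast e e' (symm S a b) = symm S a' b'.
Proof. by case: _ / ea e e'; case: _ / eb => e e'; rewrite cast_id. Qed.

End Cast.

Section Presheaves.
Variables (disp : Order.disp_t) (K : porderType disp) (C : numClosedFieldType).

Record presheaf := Presheaf {
  fibre :> K -> cstarCat C;
  res : forall o o', (o <= o')%O -> starFunctor (fibre o') (fibre o);
  res_inj : forall o o' (h : (o <= o')%O) (a b : obj (fibre o')),
    injective (@fhom _ _ _ (res h) a b);
  res_res_obj : forall o o' o'' (h : (o <= o')%O) (h' : (o' <= o'')%O)
      (h'' : (o <= o'')%O) (a : obj (fibre o'')),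
    res h (res h' a) = res h'' a;
  res_res_hom : forall o o' o'' (h : (o <= o')%O) (h' : (o' <= o'')%O)
      (h'' : (o <= o'')%O) (a b : obj (fibre o'')) (f : hom a b),
    idto (res_res_obj h h' h'' b) \oc fhom (res h) (fhom (res h') f) =
    fhom (res h'') f \oc idto (res_res_obj h h' h'' a) }.

Record symTensorPresheaf := SymTensorPresheaf {
  tpresheaf :> presheaf;
  fibre_tens : forall o, symTensor (tpresheaf o);
  fibre_unit : forall o, simple_unit (fibre_tens o);
  res_tens : forall o o' (h : (o <= o')%O),
    tensorFunctor (fibre_tens o') (fibre_tens o) (res tpresheaf h) }.

Variable T : symTensorPresheaf.
Local Notation S := (@fibre_tens T _).

Record secobj := Secobj {
  sobj :> forall o, obj (T o);
  sobjE : forall o o' (h : (o <= o')%O), res T h (sobj o') = sobj o }.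

Lemma secobj_eq (r s : secobj) : (forall o, r o = s o) -> r = s.
Proof.
case: r s => r hr [s hs] /= E.
have e : r = s := functional_extensionality_dep E.
by case: _ / e hs {E} => hs; rewrite (Prop_irrelevance hr hs).
Qed.

Definition sres (r s : secobj) o o' (h : (o <= o')%O) (t : hom (r o') (s o')) :
  hom (r o) (s o) := hcast (sobjE r h) (sobjE s h) (fhom (res T h) t).

Lemma sres_lin (r s : secobj) o o' (h : (o <= o')%O) k (f g : hom (r o') (s o')) :
  sres h (k *: f + g) = k *: sres h f + sres h g.
Proof. by rewrite /sres fhom_lin cast_lin. Qed.

Lemma sres_idm (r : secobj) o o' (h : (o <= o')%O) :
  sres h (idm (r o')) = idm (r o).
Proof. by rewrite /sres fhom1 cast_idm. Qed.

Lemma sres_comp (r s t : secobj) o o' (h : (o <= o')%O)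
    (g : hom (s o') (t o')) (f : hom (r o') (s o')) :
  sres h (g \oc f) = sres h g \oc sres h f.
Proof. by rewrite /sres fhomM; exact: cast_comp. Qed.

Lemma sres_adj (r s : secobj) o o' (h : (o <= o')%O) (f : hom (r o') (s o')) :
  sres h (adj f) = adj (sres h f).
Proof. by rewrite /sres fhom_adj cast_adj. Qed.

Lemma sres_inj (r s : secobj) o o' (h : (o <= o')%O) :
  injective (@sres r s o o' h).
Proof.
move=> f g /(congr1 (hcast (esym (sobjE r h)) (esym (sobjE s h)))).
by rewrite !castK => /res_inj.
Qed.

Lemma sres_sres (r s : secobj) o o' o'' (h : (o <= o')%O) (h' : (o' <= o'')%O)
    (h'' : (o <= o'')%O) (f : hom (r o'') (s o'')) :
  sres h (sres h' f) = sres h'' f.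
Proof.
rewrite /sres.
have fcast a b a' b' (ea : a = a') (eb : b = b') (x : hom a b)
    (ea' : res T h a = res T h a') (eb' : res T h b = res T h b') :
    fhom (res T h) (hcast ea eb x) = hcast ea' eb' (fhom (res T h) x).
  by case: _ / ea ea'; case: _ / eb eb' => eb' ea'; rewrite !cast_id.
rewrite (fcast _ _ _ _ _ _ _ (f_equal (res T h) (sobjE r h'))
  (f_equal (res T h) (sobjE s h'))).
rewrite -(cast_move (res_res_hom h h' h'' f)).
rewrite (cast_cast _ _ _ _ (etrans (f_equal (res T h) (sobjE r h')) (sobjE r h))
  (etrans (f_equal (res T h) (sobjE s h')) (sobjE s h))).
by rewrite (cast_cast _ _ _ _ (etrans (f_equal (res T h) (sobjE r h')) (sobjE r h))
  (etrans (f_equal (res T h) (sobjE s h')) (sobjE s h))).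
Qed.

Lemma sres_xx (r s : secobj) o (h : (o <= o)%O) (f : hom (r o) (s o)) :
  sres h f = f.
Proof. by apply: (@sres_inj _ _ _ _ h); rewrite (sres_sres h h h). Qed.

Definition sec_tobj (r s : secobj) : secobj.
Proof.
exists (fun o => tobj S (r o) (s o)) => o o' h.
exact: etrans (ftobj (res_tens T h) _ _)
  (f_equal2 (tobj S) (sobjE r h) (sobjE s h)).
Defined.

Definition sec_tunit : secobj.
Proof.
exists (fun o => tunit S) => o o' h; exact: ftunit (res_tens T h).
Defined.

Lemma sres_tens (r s r' s' : secobj) o o' (h : (o <= o')%O)
    (f : hom (r o') (s o')) (f' : hom (r' o') (s' o')) :
  @sres (sec_tobj r r') (sec_tobj s s') o o' h (tens S f f') =
  tens S (sres h f) (sres h f').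
Proof.
rewrite /sres -(cast_tens _ _ _ _ (f_equal2 (tobj S) (sobjE r h) (sobjE r' h))
  (f_equal2 (tobj S) (sobjE s h) (sobjE s' h))).
rewrite -(cast_move (fhom_tens (res_tens T h) f f')); symmetry.
exact: cast_cast.
Qed.

Lemma sres_sym (r s : secobj) o o' (h : (o <= o')%O) :
  @sres (sec_tobj r s) (sec_tobj s r) o o' h (symm S (r o') (s o')) =
  symm S (r o) (s o).
Proof.
rewrite /sres -(cast_sym (sobjE r h) (sobjE s h)
  (f_equal2 (tobj S) (sobjE r h) (sobjE s h))
  (f_equal2 (tobj S) (sobjE s h) (sobjE r h))).
rewrite -(cast_move (fhom_sym (res_tens T h) (r o') (s o'))); symmetry.
exact: cast_cast.
Qed.

Lemma sres_idto (r s : secobj) o o' (h : (o <= o')%O) (e : r o' = s o')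
  (e' : r o = s o) : sres h (idto e) = idto e'.
Proof.
have e'' : res T h (r o') = res T h (s o') by rewrite e.
by rewrite /sres (fhom_idto e e''); exact: cast_idto.
Qed.

Record secarr (r s : secobj) := Secarr {
  sarr :> forall o, hom (r o) (s o);
  sarrE : forall o o' (h : (o <= o')%O), sres h (sarr o') = sarr o }.

HB.instance Definition _ r s := gen_eqMixin (secarr r s).
HB.instance Definition _ r s := gen_choiceMixin (secarr r s).

Lemma secarr_eq (r s : secobj) (f g : secarr r s) :
  (forall o, f o = g o) -> f = g.
Proof.
case: f g => f hf [g hg] /= E.
have e : f = g := functional_extensionality_dep E.
by case: _ / e hg {E} => hg; rewrite (Prop_irrelevance hf hg).
Qed.

Section SecLmod.
Variables r s : secobj.

Lemma sres0 o o' (h : (o <= o')%O) : sres h (0 : hom (r o') (s o')) = 0.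
Proof.
have := sres_lin h (-1) (0 : hom (r o') (s o')) 0.
by rewrite scaleN1r addNr scaleN1r addNr.
Qed.

Definition sec_comb (k : C) (f g : secarr r s) : secarr r s.
Proof.
by exists (fun o => k *: f o + g o) => o o' h; rewrite sres_lin !sarrE.
Defined.
Definition sec_zero : secarr r s.
Proof. by exists (fun o => 0) => o o' h; exact: sres0. Defined.
Definition sec_add (f g : secarr r s) := sec_comb 1 f g.
Definition sec_opp (f : secarr r s) := sec_comb (-1) f sec_zero.
Definition sec_scale (k : C) (f : secarr r s) := sec_comb k f sec_zero.

Lemma sec_addA : associative sec_add.
Proof. by move=> f g h; apply: secarr_eq => o /=; rewrite !scale1r addrA. Qed.
Lemma sec_addC : commutative sec_add.
Proof. by move=> f g; apply: secarr_eq => o /=; rewrite !scale1r addrC. Qed.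
Lemma sec_add0 : left_id sec_zero sec_add.
Proof. by move=> f; apply: secarr_eq => o /=; rewrite scale1r add0r. Qed.
Lemma sec_addN : left_inverse sec_zero sec_opp sec_add.
Proof.
by move=> f; apply: secarr_eq => o /=; rewrite scale1r addr0 scaleN1r addNr.
Qed.

HB.instance Definition _ :=
  GRing.isZmodule.Build (secarr r s) sec_addA sec_addC sec_add0 sec_addN.

Lemma secarrD (f g : secarr r s) o : (f + g) o = f o + g o.
Proof. by rewrite /= scale1r. Qed.

Lemma sec_scaleE k (f : secarr r s) o : sec_scale k f o = k *: f o.
Proof. by rewrite /= addr0. Qed.

Lemma sec_scaleA k l (f : secarr r s) :
  sec_scale k (sec_scale l f) = sec_scale (k * l) f.
Proof. by apply: secarr_eq => o; rewrite !sec_scaleE scalerA. Qed.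
Lemma sec_scale1 : left_id 1 sec_scale.
Proof. by move=> f; apply: secarr_eq => o; rewrite sec_scaleE scale1r. Qed.
Lemma sec_scaleDr : right_distributive sec_scale +%R.
Proof.
move=> k f g; apply: secarr_eq => o.
by rewrite secarrD !sec_scaleE secarrD scalerDr.
Qed.
Lemma sec_scaleDl f : {morph sec_scale^~ f : k l / k + l}.
Proof.
by move=> k l; apply: secarr_eq => o; rewrite secarrD !sec_scaleE scalerDl.
Qed.

HB.instance Definition _ := GRing.Zmodule_isLmodule.Build C (secarr r s)
  sec_scaleA sec_scale1 sec_scaleDr sec_scaleDl.

Lemma secarr_lin k (f g : secarr r s) o : (k *: f + g) o = k *: f o + g o.
Proof. by rewrite secarrD sec_scaleE. Qed.

End SecLmod.

Definition sec_idm (r : secobj) : secarr r r.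
Proof. by exists (fun o => idm (r o)) => o o' h; exact: sres_idm. Defined.
Definition sec_comp (r s t : secobj) (g : secarr s t) (f : secarr r s) :
  secarr r t.
Proof.
by exists (fun o => g o \oc f o) => o o' h; rewrite sres_comp !sarrE.
Defined.
Definition sec_adj (r s : secobj) (f : secarr r s) : secarr s r.
Proof. by exists (fun o => adj (f o)) => o o' h; rewrite sres_adj sarrE. Defined.

Definition sec_star :
  starStructure (fun r s : secobj => secarr r s : lmodType C).
Proof.
exists sec_idm sec_comp sec_adj.
- by move=> *; apply: secarr_eq => o; exact: compA.
- by move=> *; apply: secarr_eq => o; exact: comp1m.
- by move=> *; apply: secarr_eq => o; exact: compm1.
- move=> a b c f k g g'; apply: secarr_eq => o; rewrite [RHS]secarr_lin.
  by rewrite -[LHS]/((k *: g + g') o \oc f o) secarr_lin comp_linl.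
- move=> a b c g k f f'; apply: secarr_eq => o; rewrite [RHS]secarr_lin.
  by rewrite -[LHS]/(g o \oc (k *: f + f') o) secarr_lin comp_linr.
- move=> a b k f f'; apply: secarr_eq => o; rewrite [RHS]secarr_lin.
  by rewrite -[LHS]/(adj ((k *: f + f') o)) secarr_lin adj_lin.
- by move=> *; apply: secarr_eq => o; exact: adjK.
- by move=> *; apply: secarr_eq => o; exact: adjM.
Defined.

Definition section_cat : starCat C := StarCat sec_star.

Lemma sec_idto (r s : secobj) (e : r = s) o (e' : r o = s o) :
  sarr (@idto _ section_cat r s e) o = idto e'.
Proof. by case: _ / e e' => e'; rewrite (idto_id e'). Qed.

Definition sec_tens (r s r' s' : secobj) (f : secarr r s) (f' : secarr r' s') :
  secarr (sec_tobj r r') (sec_tobj s s').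
Proof.
by exists (fun o => tens S (f o) (f' o)) => o o' h; rewrite sres_tens !sarrE.
Defined.

Definition sec_sym (r s : secobj) : secarr (sec_tobj r s) (sec_tobj s r).
Proof.
by exists (fun o => symm S (r o) (s o)) => o o' h; exact: sres_sym.
Defined.

Lemma sec_tobjA (r s t : secobj) :
  sec_tobj (sec_tobj r s) t = sec_tobj r (sec_tobj s t).
Proof. by apply: secobj_eq => o; exact: tobjA. Qed.
Lemma sec_tobj1l (r : secobj) : sec_tobj sec_tunit r = r.
Proof. by apply: secobj_eq => o; exact: tobj1l. Qed.
Lemma sec_tobj1r (r : secobj) : sec_tobj r sec_tunit = r.
Proof. by apply: secobj_eq => o; exact: tobj1r. Qed.

Definition section_tensor : symTensor section_cat.
Proof.
exists sec_tobj sec_tunit sec_tobjA sec_tobj1l sec_tobj1r sec_tens sec_sym.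
- move=> a b a' b' k f g h; apply: secarr_eq => o; rewrite [RHS]secarr_lin.
  by rewrite -[LHS]/(tens S ((k *: f + g : secarr a b) o) (h o)) secarr_lin tens_linl.
- move=> a b a' b' k h f g; apply: secarr_eq => o; rewrite [RHS]secarr_lin.
  by rewrite -[LHS]/(tens S (h o) ((k *: f + g : secarr a' b') o)) secarr_lin tens_linr.
- by move=> *; apply: secarr_eq => o; exact: tens1.
- by move=> *; apply: secarr_eq => o; exact: tensM.
- by move=> *; apply: secarr_eq => o; exact: tens_adj.
- move=> a b a' b' a'' b'' f f' f''; apply: secarr_eq => o /=.
  rewrite (@sec_idto _ _ (sec_tobjA _ _ _) o (tobjA S _ _ _)).
  by rewrite (@sec_idto _ _ (sec_tobjA _ _ _) o (tobjA S _ _ _)) tensA.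
- move=> a b f; apply: secarr_eq => o /=.
  rewrite (@sec_idto _ _ (sec_tobj1l _) o (tobj1l S _)).
  by rewrite (@sec_idto _ _ (sec_tobj1l _) o (tobj1l S _)) tens1l.
- move=> a b f; apply: secarr_eq => o /=.
  rewrite (@sec_idto _ _ (sec_tobj1r _) o (tobj1r S _)).
  by rewrite (@sec_idto _ _ (sec_tobj1r _) o (tobj1r S _)) tens1r.
- by move=> *; apply: secarr_eq => o; exact: sym_nat.
- by move=> *; apply: secarr_eq => o; exact: symK.
- by move=> *; apply: secarr_eq => o; exact: sym_adj.
- move=> a; apply: secarr_eq => o /=.
  rewrite (@sec_idto _ _ (sec_tobj1r _) o (tobj1r S _)).
  rewrite (@sec_idto _ _ (esym (sec_tobj1l _)) o (esym (tobj1l S _))).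
  exact: (sym1 (fibre_tens T o) (a o)).
- move=> a b c; apply: secarr_eq => o /=.
  rewrite (@sec_idto _ _ (sec_tobjA c a b) o (tobjA S _ _ _)).
  rewrite (@sec_idto _ _ (esym (sec_tobjA a c b)) o (esym (tobjA S _ _ _))).
  rewrite (@sec_idto _ _ (sec_tobjA a b c) o (tobjA S _ _ _)).
  exact: (sym_hex (fibre_tens T o) (a o) (b o) (c o)).
Defined.

(* The C*-norm of the section category is not a datum: the injective *-functors
   r_{oo'} being isometric, it is the supremum of the fibrewise norms. *)
Definition DR_presheaf : Prop := DR_category section_tensor.

End Presheaves.

Section AssociatedBundle.
Variables (disp : Order.disp_t) (K : porderType disp) (C : numClosedFieldType).
Variable T : symTensorPresheaf K C.
Local Notation S := (@fibre_tens _ _ _ T _).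
Implicit Types r s t : secobj T.

Definition phi a r s (f : hom (r a) (s a)) : Prop :=
  exists x : forall o, (a <= o)%O -> hom (r o) (s o),
    (forall o o' (h : (a <= o)%O) (h' : (a <= o')%O) (i : (o <= o')%O),
      sres i (x o' h') = x o h) /\
    x a (lexx a) = f.

Definition phib a r s : {pred hom (r a) (s a)} := [pred f | `[< phi f >]].
Arguments phib : clear implicits.

Lemma phi_lin a r s k (f g : hom (r a) (s a)) :
  phi f -> phi g -> phi (k *: f + g).
Proof.
move=> [x [hx <-]] [y [hy <-]]; exists (fun o h => k *: x o h + y o h).
by split=> // o o' h h' i; rewrite sres_lin (hx _ _ h) (hy _ _ h).
Qed.

Lemma phi_submod a r s : submod_closed (phib a r s).
Proof.
split=> [|k f g /asboolP hf /asboolP hg]; apply/asboolP; last exact: phi_lin.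
by exists (fun o _ => 0); split=> // o o' h h' i; exact: sres0.
Qed.

HB.instance Definition _ a r s :=
  GRing.isSubmodClosed.Build C (hom (r a) (s a)) (phib a r s) (phi_submod a r s).

Definition bhom a r s := {f : hom (r a) (s a) | f \in phib a r s}.
HB.instance Definition _ a r s := Choice.on (bhom a r s).
HB.instance Definition _ a r s := SubType.on (bhom a r s).
HB.instance Definition _ a r s :=
  [SubChoice_isSubLmodule of bhom a r s by <:].
Arguments bhom : clear implicits.

Lemma bhomP a r s (f : bhom a r s) : phi (val f).
Proof. by case: f => f hf; apply/asboolP. Qed.

Definition mkbhom a r s (f : hom (r a) (s a)) (h : phi f) : bhom a r s :=
  Sub f (introT (asboolP (phi f)) h).

Lemma phi_idm a r : phi (idm (r a)).
Proof.
by exists (fun o _ => idm (r o)); split=> // o o' h h' i; exact: sres_idm.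
Qed.

Lemma phi_comp a r s t (g : hom (s a) (t a)) (f : hom (r a) (s a)) :
  phi g -> phi f -> phi (g \oc f).
Proof.
move=> [x [hx <-]] [y [hy <-]]; exists (fun o h => x o h \oc y o h).
by split=> // o o' h h' i; rewrite sres_comp (hx _ _ h) (hy _ _ h).
Qed.

Lemma phi_adj a r s (f : hom (r a) (s a)) : phi f -> phi (adj f).
Proof.
move=> [x [hx <-]]; exists (fun o h => adj (x o h)).
by split=> // o o' h h' i; rewrite sres_adj (hx _ _ h).
Qed.

Lemma phi_tens a r s r' s' (f : hom (r a) (s a)) (f' : hom (r' a) (s' a)) :
  phi f -> phi f' ->
  @phi a (sec_tobj r r') (sec_tobj s s') (tens S f f').
Proof.
move=> [x [hx <-]] [y [hy <-]]; exists (fun o h => tens S (x o h) (y o h)).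
by split=> // o o' h h' i; rewrite sres_tens (hx _ _ h) (hy _ _ h).
Qed.

Lemma phi_sym a r s :
  @phi a (sec_tobj r s) (sec_tobj s r) (symm S (r a) (s a)).
Proof.
exists (fun o _ => symm S (r o) (s o)).
by split=> // o o' h h' i; exact: sres_sym.
Qed.

Definition beta_star a : starStructure (fun r s => bhom a r s : lmodType C).
Proof.
exists (fun r => mkbhom (phi_idm a r))
  (fun r s t g f => mkbhom (phi_comp (bhomP g) (bhomP f)))
  (fun r s f => mkbhom (phi_adj (bhomP f))).
- by move=> *; apply: val_inj; exact: compA.
- by move=> *; apply: val_inj; exact: comp1m.
- by move=> *; apply: val_inj; exact: compm1.
- by move=> *; apply: val_inj; exact: comp_linl.
- by move=> *; apply: val_inj; exact: comp_linr.
- by move=> *; apply: val_inj; exact: adj_lin.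
- by move=> *; apply: val_inj; exact: adjK.
- by move=> *; apply: val_inj; exact: adjM.
Defined.

(* The object r of beta_cat a stands for the pair (r, a). *)
Definition beta_cat a : starCat C := StarCat (beta_star a).

Lemma beta_idto a r s (e : r = s) (e' : r a = s a) :
  val (@idto _ (beta_cat a) r s e : bhom a r s) = idto e'.
Proof. by case: _ / e e' => e'; rewrite (idto_id e'). Qed.

Definition beta_tensor a : symTensor (beta_cat a).
Proof.
exists (@sec_tobj _ _ _ T) (sec_tunit T) (@sec_tobjA _ _ _ T)
  (@sec_tobj1l _ _ _ T) (@sec_tobj1r _ _ _ T)
  (fun r s r' s' f f' => mkbhom (phi_tens (bhomP f) (bhomP f')))
  (fun r s => mkbhom (phi_sym a r s)).
- by move=> *; apply: val_inj; exact: tens_linl.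
- by move=> *; apply: val_inj; exact: tens_linr.
- by move=> *; apply: val_inj; exact: tens1.
- by move=> *; apply: val_inj; exact: tensM.
- by move=> *; apply: val_inj; exact: tens_adj.
- move=> r s r' s' r'' s'' f f' f''; apply: val_inj => /=.
  rewrite (beta_idto (sec_tobjA s s' s'') (tobjA S (s a) (s' a) (s'' a))).
  rewrite (beta_idto (sec_tobjA r r' r'') (tobjA S (r a) (r' a) (r'' a))).
  exact: (tensA (fibre_tens T a) (val f) (val f') (val f'')).
- move=> r s f; apply: val_inj => /=.
  rewrite (beta_idto (sec_tobj1l s) (tobj1l S (s a))).
  rewrite (beta_idto (sec_tobj1l r) (tobj1l S (r a))).
  exact: (tens1l (fibre_tens T a) (val f)).
- move=> r s f; apply: val_inj => /=.
  rewrite (beta_idto (sec_tobj1r s) (tobj1r S (s a))).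
  rewrite (beta_idto (sec_tobj1r r) (tobj1r S (r a))).
  exact: (tens1r (fibre_tens T a) (val f)).
- by move=> *; apply: val_inj; exact: sym_nat.
- by move=> *; apply: val_inj; exact: symK.
- by move=> *; apply: val_inj; exact: sym_adj.
- move=> r; apply: val_inj => /=.
  rewrite (beta_idto (sec_tobj1r r) (tobj1r S (r a))).
  rewrite (beta_idto (esym (sec_tobj1l r)) (esym (tobj1l S (r a)))).
  exact: (sym1 (fibre_tens T a) (r a)).
- move=> r s t; apply: val_inj => /=.
  rewrite (beta_idto (sec_tobjA t r s) (tobjA S (t a) (r a) (s a))).
  rewrite (beta_idto (esym (sec_tobjA r t s)) (esym (tobjA S (r a) (t a) (s a)))).
  rewrite (beta_idto (sec_tobjA r s t) (tobjA S (r a) (s a) (t a))).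
  exact: (sym_hex (fibre_tens T a) (r a) (s a) (t a)).
Defined.

(* The restriction functors of the associated bundle are defined when r_{oo'}
   maps phi at o' into phi at o.  They are then isomorphisms, because r_{oo'} is
   injective on arrows and every element of phi at o has a preimage in phi at
   o' (phi_up). *)
Definition beta_bundle : Prop :=
  forall o o' (h : (o <= o')%O) r s (f : hom (r o') (s o')),
    phi f -> phi (sres h f).

Lemma phi_up o o' (h : (o <= o')%O) r s (f : hom (r o) (s o)) :
  phi f -> exists2 f' : hom (r o') (s o'), phi f' & sres h f' = f.
Proof.
move=> [x [hx <-]]; exists (x o' h); last exact: hx.
exists (fun o'' h'' => x o'' (le_trans h h'')); split=> [p q i i' j|].
  exact: hx.
by rewrite (bool_irrelevance (le_trans h (lexx o')) h).
Qed.

Hypothesis bundleT : beta_bundle.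

Definition beta_res r s o o' (h : (o <= o')%O) (f : bhom o' r s) : bhom o r s :=
  mkbhom (bundleT h (bhomP f)).

Lemma beta_res_surj r s o o' (h : (o <= o')%O) (f : bhom o r s) :
  exists f', beta_res h f' = f.
Proof.
have [f' hf' e] := phi_up h (bhomP f).
by exists (mkbhom hf'); apply: val_inj.
Qed.

Definition beta_ext r s o o' (h : (o <= o')%O) (f : bhom o r s) : bhom o' r s :=
  sval (cid (beta_res_surj h f)).

Lemma beta_extK r s o o' (h : (o <= o')%O) :
  cancel (@beta_ext r s o o' h) (@beta_res r s o o' h).
Proof. by move=> f; exact: svalP (cid (beta_res_surj h f)). Qed.

Lemma beta_resK r s o o' (h : (o <= o')%O) :
  cancel (@beta_res r s o o' h) (@beta_ext r s o o' h).
Proof.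
move=> f; apply: val_inj; apply: (@sres_inj _ _ _ _ _ _ _ _ h).
exact: (congr1 val (beta_extK h (beta_res h f))).
Qed.

Definition beta_step r s (b : simplex1 K) (f : bhom (d1 b) r s) :
  bhom (d0 b) r s := beta_res (d0_le b) (beta_ext (d1_le b) f).

Fixpoint transport r s (p : seq (simplex1 K)) (o o' : K) :
    chain o o' p -> bhom o r s -> bhom o' r s :=
  match p return chain o o' p -> bhom o r s -> bhom o' r s with
  | [::] => fun h f => ecast x (bhom x r s) (eqP h) f
  | b :: q => fun h f =>
      ecast x (bhom x r s) (eqP (proj1 (andP h)))
        (beta_step (transport (proj2 (andP h)) f))
  end.

Lemma path_chain (o o' : K) (p : kpath o o') : chain o o' (val p).
Proof. by case/andP: (valP p). Qed.

Definition holonomy_aut (a : K) (p : kpath a a) (r s : obj (beta_cat a))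
    (f : hom r s) : hom r s := transport (path_chain p) f.

End AssociatedBundle.

Section Embedding.
Variables (C : numClosedFieldType).

Definition flipmx m n : 'M[C]_(n * m, m * n) :=
  \matrix_(i, j) (((mxtens_unindex i).1 == (mxtens_unindex j).2) &&
                  ((mxtens_unindex i).2 == (mxtens_unindex j).1))%:R.

(* A symmetric tensor embedding of (B, S) into Hilbert spaces, whose image is a
   full subcategory of the dual of G.  Finite-dimensional Hilbert spaces are
   taken of the form C^n, bounded operators being matrices acting on columns,
   with tensor product *t.  The unitaries emb_J : I(a) (x) I(b) -> I(ab) and
   emb_J1 : C -> I(1) are the structure maps of the tensor functor; emb_rep is
   the unitary representation of G carried by the objects in the image. *)
Record dualEmbedding (B : starCat C) (S : symTensor B)
    (G : topologicalGroupType) := DualEmbedding {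
  edim : obj B -> nat;
  emap : forall a b, hom a b -> 'M[C]_(edim b, edim a);
  emap_lin : forall a b k (f g : hom a b),
    emap (k *: f + g) = k *: emap f + emap g;
  emap1 : forall a, emap (idm a) = 1%:M;
  emapM : forall a b c (g : hom b c) (f : hom a b),
    emap (g \oc f) = emap g *m emap f;
  emap_adj : forall a b (f : hom a b), emap (adj f) = (emap f) ^t*;
  emap_inj : forall a b, injective (@emap a b);
  emb_J : forall a b, 'M[C]_(edim (tobj S a b), edim a * edim b);
  emb_J1 : 'M[C]_(edim (tunit S), 1);
  emb_J_unitary : forall a b,
    emb_J a b \is unitarymx /\ (emb_J a b) ^t* \is unitarymx;
  emb_J1_unitary : emb_J1 \is unitarymx /\ emb_J1 ^t* \is unitarymx;
  emb_J_nat : forall a b a' b' (f : hom a b) (f' : hom a' b'),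
    emap (tens S f f') *m emb_J a a' = emb_J b b' *m (emap f *t emap f');
  emb_J_assoc : forall a b c,
    emap (idto (tobjA S a b c)) *m emb_J (tobj S a b) c *m
      (emb_J a b *t (1%:M : 'M[C]_(edim c))) =
    castmx (erefl, mulnA (edim a) (edim b) (edim c))
      (emb_J a (tobj S b c) *m ((1%:M : 'M[C]_(edim a)) *t emb_J b c));
  emb_J_unitl : forall a,
    emap (idto (tobj1l S a)) *m emb_J (tunit S) a *m
      (emb_J1 *t (1%:M : 'M[C]_(edim a))) =
    castmx (erefl, esym (mul1n (edim a))) 1%:M;
  emb_J_unitr : forall a,
    emap (idto (tobj1r S a)) *m emb_J a (tunit S) *m
      ((1%:M : 'M[C]_(edim a)) *t emb_J1) =
    castmx (erefl, esym (muln1 (edim a))) 1%:M;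
  emb_J_symm : forall a b,
    emap (symm S a b) *m emb_J a b = emb_J b a *m flipmx (edim a) (edim b);
  emb_rep : forall a, G -> 'M[C]_(edim a);
  emb_rep_unitary : forall a s, emb_rep a s \is unitarymx;
  emb_rep1 : forall a, emb_rep a 1%g = 1%:M;
  emb_repM : forall a s t, emb_rep a (s * t)%g = emb_rep a s *m emb_rep a t;
  emb_rep_continuous : forall a, continuous (emb_rep a);
  emb_rep_tens : forall a b s,
    emb_rep (tobj S a b) s *m emb_J a b =
    emb_J a b *m (emb_rep a s *t emb_rep b s);
  emb_rep_unit : forall s, emb_rep (tunit S) s = 1%:M;
  emb_full : forall a b (X : 'M[C]_(edim b, edim a)),
    (forall s, X *m emb_rep a s = emb_rep b s *m X) <->
    exists f : hom a b, emap f = X }.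

Section Transformation.
Variables (B : starCat C) (S : symTensor B) (G : topologicalGroupType).
Variable E : dualEmbedding S G.

(* Natural transformations from E to E o F, for F the arrow map of a tensor
   automorphism of B which is the identity on objects. *)
Record unitaryTransf (F : forall a b : obj B, hom a b -> hom a b) :=
  UnitaryTransf {
  transf :> forall a, 'M[C]_(edim E a);
  transf_unitary : forall a, transf a \is unitarymx;
  transf_nat : forall a b (f : hom a b),
    transf b *m emap E f = emap E (F a b f) *m transf a;
  transf_tens : forall a b,
    transf (tobj S a b) *m emb_J E a b =
    emb_J E a b *m (transf a *t transf b);
  transf_unit : transf (tunit S) = 1%:M }.

Hypothesis cptG : compact [set: G].

Definition image_group (a : obj B) : compactUnitaryGroup C (edim E a).
Proof.
exists (fun M => exists s, emb_rep E a s = M).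
- by move=> _ [s <-]; exact: emb_rep_unitary.
- by exists 1%g; exact: emb_rep1.
- by move=> _ _ [s <-] [t <-]; exists (s * t)%g; exact: emb_repM.
- move=> _ [s <-]; exists (s^-1)%g.
  rewrite -[LHS]mulmx1 -(unitarymxl (emb_rep_unitary E a s)) mulmxA -emb_repM.
  by rewrite mulVg emb_rep1 mul1mx.
- have -> : [set M | exists s, emb_rep E a s = M] = emb_rep E a @` setT.
    by apply/seteqP; split=> M [s]; [exists s|exists s].
  apply: continuous_compact => //; apply: continuous_subspaceT.
  exact: emb_rep_continuous.
Defined.

End Transformation.
End Embedding.

Section Cochains.
Variables (disp : Order.disp_t) (K : porderType disp).

Definition path_frame (a : K) := forall o : K, kpath o a.

Definition frame_loop (a : K) (fr : path_frame a) (b : simplex1 K) : kpath a a :=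
  path_comp (fr (d0 b)) (path_comp (path1 b) (path_rev (fr (d1 b)))).

Variable N : groupType.

Definition cobound (z : simplex1 K -> N) (c : simplex2 K) : N :=
  (z (f0 c) * z (f2 c) * (z (f1 c))^-1)%g.

Definition cocycle (z : simplex1 K -> N) : Prop := forall c, cobound z c = 1%g.

Definition along (z : simplex1 K -> N) (o o' : K) (p : kpath o o') : N :=
  (\prod_(b <- val p) z b)%g.

End Cochains.

Section Correspondence.
Variables (disp : Order.disp_t) (K : porderType disp) (a : K).
Variables (C : numClosedFieldType) (d : nat) (G : compactUnitaryGroup C d).
Variable u : simplex1 K -> normalizer G.
Variable fr : path_frame a.
Variable chi : pi1 a -> outer G.

Definition is_lift (L : pi1 a -> normalizer G) : Prop :=
  {morph L : x y / (x * y)%g} /\ forall x, outer_proj G (L x) = chi x.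

Definition pairs : Type :=
  ((K -> normalizer G) * (simplex1 K -> normalizer G))%type.

Definition twist (p : pairs) (b : simplex1 K) : normalizer G :=
  (p.1 (d0 b) * p.2 b * u b * (p.1 (d1 b))^-1)%g.

Definition admissible (p : pairs) : Prop :=
  (forall b, in_group (p.2 b)) /\ cocycle (twist p).

(* Two pairs are equivalent when their cocycles are cohomologous, by a
   0-cochain w compatible with the values of v at the base point. *)
Definition equivalent (p p' : pairs) : Prop :=
  exists w : K -> normalizer G,
    w a = (p'.1 a * (p.1 a)^-1)%g /\
    forall b, twist p' b = (w (d0 b) * twist p b * (w (d1 b))^-1)%g.

Definition pair_classes : set (set pairs) :=
  [set [set p' | admissible p' /\ equivalent p p'] | p in admissible].

(* The pair (v, g) defines the lift L of the holonomy; conjugation by v(a) and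
   by the loop fr a of the path frame makes up for the cocycle z, extended to
   loops at a, lifting only a conjugate of the holonomy. *)
Definition defines_lift (p : pairs) (L : pi1 a -> normalizer G) : Prop :=
  forall l : kpath a a,
    L (pclass l) =
    ((p.1 a)^-1 *
     along (twist p) (path_comp (path_rev (fr a)) (path_comp l (fr a))) *
     p.1 a)%g.

Definition lift_class (L : pi1 a -> normalizer G) : set pairs :=
  [set p | admissible p /\ defines_lift p L].

End Correspondence.

(* Main.v *)
(** A unitary tensor automorphism x of the embedding fixes every intertwiner, and
    is in the image of the compact group S at rho (Tannaka duality).  The
    averaging over S is done without Haar measure: the element E of least norm
    in the closed convex hull of the matrices s (x) conj s is unique, hence fixed
    by S; its columns are intertwiners, hence fixed by x too, so no function
    linear in s (x) conj s can separate S from xS.  If x rho were not in the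
    image, such a function would exist: on a power of an object sigma containing
    both rho and the unit object, take the sum over a finite net of elements t
    of |tr (t^* s)|^2, which in the limit of large powers detects whether s is
    close to the net, because |tr| is maximal on unitary scalars only, and x is
    scalar at sigma only if it is 1 at rho.

    As transport along paths is a homotopy-invariant bijection, conjugation by
    u(l), and the quotients of u(l) by u(l'), for l homotopic to l', and of
    u(ll') by u(l)u(l'), are such automorphisms.  So u_rho normalizes G, and the
    holonomy is a well-defined morphism.

    A lift L yields the cocycle b |-> L [frame_loop b]; two cocycles with
    conjugate values on the loops at a are cohomologous, the 0-cochain being
    read off along the path frame. *)
Require Import Defs.
From HB Require Import structures.
From mathcomp Require Import all_boot all_order all_algebra.
From mathcomp Require Import all_classical all_reals all_analysis.
From mathcomp Require Import complex mxtens.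
From mathcomp Require Import ring lra.
Import Order.TTheory GRing.Theory Num.Theory.
Import numFieldNormedType.Exports.
Local Open Scope classical_set_scope.
Local Open Scope ring_scope.
Local Open Scope complex_scope.
Local Open Scope sesquilinear_scope.

Set Implicit Arguments.
Unset Strict Implicit.
Unset Printing Implicit Defensive.

Local Notation Re := complex.Re.
Local Notation Im := complex.Im.
Local Notation hom := Defs.hom.

(** * Averaging over a group of unitary matrices *)

Lemma continuous_sum (K : numFieldType) (V : topologicalType) I (r : seq I)
    (P : pred I) (F : I -> V -> K) :
  (forall i, continuous (F i)) ->
  continuous (fun x => \sum_(i <- r | P i) F i x).
Proof.
by move=> cF; apply: (continuous_big (@add_continuous K^o)) => i _; exact: cF.
Qed.

Section MinNorm.
Variables (R : realType) (n : nat).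
Implicit Types (x y : 'rV[R]_n).

Definition sqnorm x : R := \sum_i x 0 i ^+ 2.

Lemma sqnorm_continuous : continuous sqnorm.
Proof.
apply: continuous_sum => i x.
have h := @coord_continuous R 1 n ord0 i x.
exact: (cvgM h h).
Qed.

Lemma sqnorm_parallelogram x y :
  sqnorm (x - y) = 2 * sqnorm x + 2 * sqnorm y - 4 * sqnorm (2^-1 *: (x + y)).
Proof.
rewrite /sqnorm !mulr_sumr -big_split /= -sumrB; apply: eq_bigr => i _.
by rewrite !mxE; field.
Qed.

Lemma sqnorm_eq0 x : sqnorm x <= 0 -> x = 0.
Proof.
move=> h; apply/rowP => i; rewrite mxE; apply/eqP.
have h0 : 0 == sqnorm x.
  by rewrite eq_le h andbT /sqnorm sumr_ge0 // => j _; exact: sqr_ge0.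
rewrite -sqrf_eq0; move: h0; rewrite eq_sym psumr_eq0; last first.
  by move=> j _; exact: sqr_ge0.
by move/allP/(_ i); rewrite mem_index_enum => /(_ isT).
Qed.

(** A minimiser exists by compactness; the midpoint of [x] and [e] is no shorter than [e], so the
    parallelogram law bounds [sqnorm (x - e)] by 0. *)
Lemma min_sqnorm_unique (A : set 'rV[R]_n) :
  A !=set0 -> closed A -> (exists k, forall x, A x -> forall i, `|x 0 i| <= k) ->
  (forall x y, A x -> A y -> A (2^-1 *: (x + y))) ->
  exists2 e, A e & forall x, A x -> sqnorm x <= sqnorm e -> x = e.
Proof.
move=> A0 clA [k bA] midA.
have cA : compact A.
  have bc : compact [set v : 'rV[R]_n | forall i, v ord0 i \in `[- k, k]].
    apply: (@rV_compact _ _ (fun=> `[- k, k]%classic)) => _.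
    exact: segment_compact.
  apply: subclosed_compact clA bc _ => v /bA h i.
  by rewrite in_itv /= -ler_norml.
have [e /set_mem Ae mine] :=
  EVT_min_rV A0 cA (continuous_subspaceT sqnorm_continuous).
exists e => // x Ax le; apply/eqP; rewrite -subr_eq0; apply/eqP/sqnorm_eq0.
rewrite sqnorm_parallelogram.
have := mine _ (mem_set (midA _ _ Ax Ae)); lra.
Qed.
End MinNorm.

(** * Real and imaginary parts, squared moduli *)

Section ComplexReal.
Variable R : realType.
Local Notation C := R[i].

Lemma ReM (x y : C) : Re (x * y) = Re x * Re y - Im x * Im y.
Proof. by case: x; case: y. Qed.
Lemma ReD (x y : C) : Re (x + y) = Re x + Re y.
Proof. by case: x; case: y. Qed.
Lemma ReN (x : C) : Re (- x) = - Re x.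
Proof. by case: x. Qed.
Lemma Re_sum I (r : seq I) (P : pred I) (F : I -> C) :
  Re (\sum_(i <- r | P i) F i) = \sum_(i <- r | P i) Re (F i).
Proof. by rewrite (big_morph _ ReD (erefl : Re 0 = 0)). Qed.

Definition cabs2 (z : C) : R := Re (z * (z^*)%R).

Lemma cabs2E (z : C) : cabs2 z = Re z ^+ 2 + Im z ^+ 2.
Proof. by case: z => a b; rewrite /cabs2 ReM /=; ring. Qed.

Lemma cabs2M (x y : C) : cabs2 (x * y) = cabs2 x * cabs2 y.
Proof. by rewrite !cabs2E; case: x; case: y => a b c d /=; ring. Qed.

Lemma cabs2X (x : C) n : cabs2 (x ^+ n) = cabs2 x ^+ n.
Proof.
elim: n => [|n IH]; first by rewrite !expr0 cabs2E /=; ring.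
by rewrite !exprS cabs2M IH.
Qed.

Lemma cabs2_ge0 (z : C) : 0 <= cabs2 z.
Proof. by rewrite cabs2E addr_ge0 // sqr_ge0. Qed.

Lemma normr2_cabs2 (z : C) : `|z| ^+ 2 = (cabs2 z)%:C.
Proof. by rewrite cabs2E add_Re2_Im2. Qed.

(** The norm of [R[i]] takes its values in [R[i]], so real bounds and radii are embedded by
    [%:C]. *)
Lemma contraction_continuous (f : (R[i] : numClosedFieldType) -> R) :
  (forall z w, `|f z - f w|%:C <= `|z - w|) -> continuous f.
Proof.
move=> cf z U /nbhs_ballP[e /= e0 eU].
apply/nbhs_ballP; exists e%:C; first by rewrite /= ltcR.
move=> w /= h; apply: eU; rewrite -ball_normE /= -ltcR.
exact: le_lt_trans (cf _ _) h.
Qed.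

Lemma Re_continuous : continuous (@Re R : (R[i] : numClosedFieldType) -> R).
Proof.
apply: contraction_continuous => z w.
by rewrite normc_def lecR -ReN -ReD -sqrtr_sqr ler_wsqrtr // lerDl sqr_ge0.
Qed.

Lemma Im_continuous : continuous (@Im R : (R[i] : numClosedFieldType) -> R).
Proof.
apply: contraction_continuous => -[a b] [c d].
by rewrite normc_def lecR -sqrtr_sqr ler_wsqrtr // lerDr sqr_ge0.
Qed.

End ComplexReal.

Section UnitaryMean.
Variables (R : realType) (p : nat).
Local Notation C := R[i].
Implicit Types M : 'M[C]_p.

Lemma sum_mxvec (K : nmodType) m n (F : 'I_(m * n) -> K) :
  \sum_k F k = \sum_i \sum_j F (mxvec_index i j).
Proof.
rewrite (reindex _ (curry_mxvec_bij m n)) pair_bigA /=.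
by apply: eq_bigr => -[].
Qed.

(** Complex matrices become real vectors so that [min_sqnorm_unique] applies. *)
Definition mx_of_real (x : 'rV[R]_(p * p + p * p)) : 'M[C]_p :=
  \matrix_(i, j) (x 0 (lshift _ (mxvec_index i j)) +i*
                  x 0 (rshift _ (mxvec_index i j))).

Definition real_of_mx M : 'rV[R]_(p * p + p * p) :=
  row_mx (mxvec (map_mx (@Re R) M)) (mxvec (map_mx (@Im R) M)).

Lemma real_of_mxK : cancel real_of_mx mx_of_real.
Proof.
move=> M; apply/matrixP => i j.
by rewrite mxE /real_of_mx row_mxEl row_mxEr !mxvecE !mxE; case: (M i j).
Qed.

Definition frob2 M : R := Re (\tr (M ^t* *m M)).

Lemma sqnorm_frob2 x : sqnorm x = frob2 (mx_of_real x).
Proof.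
rewrite /sqnorm big_split_ord /= !sum_mxvec /frob2 /mxtrace Re_sum.
rewrite exchange_big [X in _ + X]exchange_big -big_split /=.
apply: eq_bigr => j _; rewrite mxE Re_sum -big_split; apply: eq_bigr => i _ /=.
by rewrite !mxE mulrC -[RHS]/(cabs2 _) cabs2E.
Qed.

Lemma frob2_unitary U M : U \is unitarymx -> frob2 (U *m M) = frob2 M.
Proof.
by move=> Uu; rewrite /frob2 adjmxM mulmxA -(mulmxA _ _ U) unitarymxr // mulmx1.
Qed.

Lemma Re_trM (B M : 'M[C]_p) : Re (\tr (B *m M)) =
  \sum_i \sum_j (Re (B i j) * Re (M j i) - Im (B i j) * Im (M j i)).
Proof.
rewrite /mxtrace Re_sum; apply: eq_bigr => i _.
by rewrite mxE Re_sum; apply: eq_bigr => j _; exact: ReM.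
Qed.

Lemma mx_of_real_midpoint x y :
  mx_of_real (2^-1 *: (x + y)) =
  (2^-1)%:C *: (mx_of_real x + mx_of_real y).
Proof.
apply/matrixP => i j; rewrite !mxE; apply/eqP; rewrite eq_complex /=.
by rewrite !mul0r subr0 addr0 !eqxx.
Qed.

Variables (S : Type) (Y : S -> 'M[C]_p) (s0 : S).
Hypothesis Y_unitary : forall s, Y s \is unitarymx.
Hypothesis YM : forall s t, exists r, Y r = Y s *m Y t.

(* The closed convex hull of the Y s, described as its bipolar. *)
Let hull M := forall (B : 'M[C]_p) (b : R),
  (forall s, Re (\tr (B *m Y s)) <= b) -> Re (\tr (B *m M)) <= b.

Lemma unitary_entry (U : 'M[C]_p) i j : U \is unitarymx -> cabs2 (U i j) <= 1.
Proof.
move=> Uu; have /(congr1 (fun M : 'M[C]_p => Re (M i i))) := unitarymxl Uu.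
rewrite mxE Re_sum (bigD1 j) //= !mxE eqxx => h.
rewrite -[leRHS]/(Re true%:R) -h lerDl; apply: sumr_ge0 => k _; rewrite !mxE.
exact: cabs2_ge0.
Qed.

Lemma cabs2_le1 (z : C) : cabs2 z <= 1 -> `|Re z| <= 1 /\ `|Im z| <= 1.
Proof.
rewrite cabs2E => h; split; rewrite -(ler_pXn2r (_ : 0 < 2)%N) ?nnegrE //.
  by rewrite expr1n real_normK ?num_real // (le_trans _ h) // lerDl sqr_ge0.
by rewrite expr1n real_normK ?num_real // (le_trans _ h) // lerDr sqr_ge0.
Qed.

(** Boundedness of the hull, tested on the functionals given by [c *: delta_mx j i] with [c] one of
    1, -1, i, -i: each is at most 1 on unitary matrices. *)
Lemma hull_entry M i j : hull M -> `|Re (M i j)| <= 1 /\ `|Im (M i j)| <= 1.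
Proof.
move=> hM.
have trd (c : C) N : Re (\tr (c *: delta_mx j i *m N)) =
    Re c * Re (N i j) - Im c * Im (N i j).
  rewrite -ReM; congr Re; rewrite -scalemxAl mxtraceZ; congr (_ * _).
  rewrite /mxtrace (bigD1 j) //= mxE (bigD1 i) //= mxE !eqxx mul1r.
  rewrite !big1 ?addr0 // => [k /negPf nk|k /negPf nk].
    by rewrite mxE big1 // => l _; rewrite mxE nk mul0r.
  by rewrite mxE nk andbF mul0r.
have b s := cabs2_le1 (unitary_entry i j (Y_unitary s)).
have h c : (forall s, Re c * Re (Y s i j) - Im c * Im (Y s i j) <= 1) ->
    Re c * Re (M i j) - Im c * Im (M i j) <= 1.
  by move=> hc; rewrite -trd; apply: hM => s; rewrite trd.
have h1 := h 1; have h2 := h (-1); have h3 := h 'i%C; have h4 := h (- 'i%C).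
rewrite /= in h1 h2 h3 h4.
rewrite !ler_norml; split; apply/andP; split.
- suff : -1 * Re (M i j) - - 0 * Im (M i j) <= 1 by lra.
  by apply: h2 => s; have [/ler_normlP[] ] := b s; lra.
- suff : 1 * Re (M i j) - 0 * Im (M i j) <= 1 by lra.
  by apply: h1 => s; have [/ler_normlP[] ] := b s; lra.
- suff : 0 * Re (M i j) - 1 * Im (M i j) <= 1 by lra.
  by apply: h3 => s; have [_ /ler_normlP[] ] := b s; lra.
- suff : - 0 * Re (M i j) - -1 * Im (M i j) <= 1 by lra.
  by apply: h4 => s; have [_ /ler_normlP[] ] := b s; lra.
Qed.

Lemma hull_closed : closed [set x | hull (mx_of_real x)].
Proof.
have -> : [set x | hull (mx_of_real x)] =
    \bigcap_(Bb in [set Bb : 'M[C]_p * R |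
        forall s, Re (\tr (Bb.1 *m Y s)) <= Bb.2])
      [set x | Re (\tr (Bb.1 *m mx_of_real x)) <= Bb.2].
  apply/seteqP; split=> [x h [B b] /= hb|x h B b hb]; first exact: h.
  exact: (h (B, b)).
apply: closed_bigI => -[B b] _ /=.
apply: (@preimage_closed _ _ _ [set r : R | r <= b]); last exact: closed_le.
move=> x _.
have -> : (fun x => Re (\tr (B *m mx_of_real x))) = (fun x => \sum_i \sum_j
    (Re (B i j) * x 0 (lshift _ (mxvec_index j i)) -
     Im (B i j) * x 0 (rshift _ (mxvec_index j i)))).
  by apply/funext => y; rewrite Re_trM; do 2!apply: eq_bigr => ? _; rewrite mxE.
apply: continuous_sum => i; apply: continuous_sum => j y.
have lc (b' : R) k : continuous (fun z : 'rV[R]_(p * p + p * p) => b' * z 0 k).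
  by move=> z; exact: (cvgM (cvg_cst _) (@coord_continuous R 1 _ ord0 k z)).
exact: (cvgB (lc _ _ _) (lc _ _ _)).
Qed.

Lemma unitary_mean : exists E : 'M[C]_p,
  (forall s, Y s *m E = E) /\
  forall (B : 'M[C]_p) (b : R),
    (forall s, Re (\tr (B *m Y s)) <= b) -> Re (\tr (B *m E)) <= b.
Proof.
have [||||x hx min] := @min_sqnorm_unique R _ [set x | hull (mx_of_real x)].
- by exists (real_of_mx (Y s0)); rewrite /= real_of_mxK => B b; exact.
- exact: hull_closed.
- exists 1 => x hx k; case: (split_ordP k) => l ->;
    case/mxvec_indexP: l => i j; by have [] := hull_entry i j hx; rewrite !mxE.
- move=> x y hx hy B b hb; rewrite /= mx_of_real_midpoint.
  have := hx _ _ hb; have := hy _ _ hb.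
  rewrite -scalemxAr mxtraceZ mulmxDr mxtraceD ReM ReD /= mul0r subr0; lra.
exists (mx_of_real x); split=> // s.
(* A functional composed with left multiplication by [Y s] keeps its bound, as the family is closed
   under products. *)
have hsx : hull (Y s *m mx_of_real x).
  move=> B b hb; rewrite mulmxA; apply: hx => t; rewrite -mulmxA.
  by have [r <-] := YM s t.
rewrite -[LHS]real_of_mxK (min (real_of_mx _)) //= ?real_of_mxK //.
by rewrite !sqnorm_frob2 real_of_mxK frob2_unitary.
Qed.

End UnitaryMean.


(** * Traces of unitary matrices *)

Lemma trace_defect (C : numClosedFieldType) n (U : 'M[C]_n) :
  U \is unitarymx ->
  \tr ((n%:R *: U - (\tr U)%:M) ^t* *m (n%:R *: U - (\tr U)%:M)) =
  n%:R * (n%:R ^+ 2 - \tr U * ((\tr U)^*)%R).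
Proof.
move=> Uu; set t := \tr U.
have trV : \tr (U ^t*) = (t^*)%R.
  by rewrite /t /mxtrace rmorph_sum; apply: eq_bigr => i _; rewrite !mxE.
have -> : (n%:R *: U - t%:M) ^t* = n%:R *: U ^t* - ((t^*)%R)%:M.
  apply/matrixP => i j.
  by rewrite !mxE rmorphB rmorphM rmorph_nat rmorphMn eq_sym.
rewrite mulmxBl !mulmxBr -!scalemxAl -!scalemxAr unitarymxr //.
rewrite !mul_mx_scalar !mul_scalar_mx.
have trB (X Y : 'M[C]_n) : \tr (X - Y) = \tr X - \tr Y by exact: raddfB.
have trU : \tr U = t by [].
rewrite !trB !mxtraceZ trV trU; move: t {trU trV} => t.
by rewrite !mxtrace_scalar; ring.
Qed.

Section UnitaryTrace.
Variable R : realType.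
Local Notation C := R[i].

Lemma frob2E n (M : 'M[C]_n) : frob2 M = \sum_i \sum_j cabs2 (M i j).
Proof.
rewrite /frob2 /mxtrace Re_sum exchange_big; apply: eq_bigr => j _.
rewrite mxE Re_sum; apply: eq_bigr => i _.
by rewrite !mxE mulrC.
Qed.

Lemma frob2_ge0 n (M : 'M[C]_n) : 0 <= frob2 M.
Proof. by rewrite frob2E; do 2!apply: sumr_ge0 => ? _; exact: cabs2_ge0. Qed.

Lemma frob2_eq0 n (M : 'M[C]_n) : frob2 M = 0 -> M = 0.
Proof.
move=> h; apply/matrixP => i j; rewrite mxE; apply/eqP.
have e : cabs2 (M i j) = 0.
  apply/eqP; rewrite eq_le cabs2_ge0 andbT -h frob2E (bigD1 i) //= (bigD1 j) //=.
  rewrite -addrA lerDl addr_ge0 ?sumr_ge0 // => *; first exact: cabs2_ge0.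
  by apply: sumr_ge0 => ? _; exact: cabs2_ge0.
by rewrite -normr_eq0 -sqrf_eq0 normr2_cabs2 e.
Qed.

(** The equality case of Cauchy-Schwarz for the trace: the distance from [U] to the scalars measures
    how far its trace is from maximal modulus. *)
Lemma frob2_unitary_trace n (U : 'M[C]_n) : U \is unitarymx ->
  frob2 (n%:R *: U - (\tr U)%:M) = n%:R * (n%:R ^+ 2 - cabs2 (\tr U)).
Proof.
move=> Uu; rewrite /frob2 trace_defect //.
rewrite -(rmorph_nat (real_complex R)) -/(real_complex R) -rmorphXn /=.
by rewrite ReM mul0r subr0 ReD ReN.
Qed.

Lemma cabs2_trace_le n (U : 'M[C]_n) : U \is unitarymx ->
  cabs2 (\tr U) <= n%:R ^+ 2.
Proof.
(* In dimension 0 the factor [n] cannot be cancelled, but the trace is an empty sum. *)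
case: n => [|n] in U * => Uu.
  by rewrite /mxtrace big_ord0 cabs2E /= expr0n /= addr0.
rewrite -subr_ge0 -(pmulr_rge0 _ (ltr0Sn R n)) -frob2_unitary_trace //.
exact: frob2_ge0.
Qed.

Lemma cabs2_trace_eq n (U : 'M[C]_n) : (0 < n)%N -> U \is unitarymx ->
  cabs2 (\tr U) = n%:R ^+ 2 -> exists k : C, U = k%:M.
Proof.
move=> n0 Uu h; have := frob2_unitary_trace Uu.
rewrite h subrr mulr0 => /frob2_eq0 /eqP; rewrite subr_eq0 => /eqP e.
exists (n%:R^-1 * \tr U); rewrite -scale_scalar_mx -e scalerA mulVf ?scale1r //.
by rewrite pnatr_eq0 -lt0n.
Qed.

End UnitaryTrace.

(** * Tensor products of matrices and commutants *)

Section TensorTrace.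
Variable C : numClosedFieldType.

Lemma sum_mxtens (K : nmodType) m n (F : 'I_(m * n) -> K) :
  \sum_k F k = \sum_i \sum_j F (mxtens_index (i, j)).
Proof.
rewrite pair_bigA /= (reindex (@mxtens_index m n)) /=; last first.
  by apply: onW_bij; exists (@mxtens_unindex m n);
    [exact: mxtens_indexK|exact: mxtens_unindexK].
by apply: eq_bigr => -[].
Qed.

Lemma mxtrace_tens m n (A : 'M[C]_m) (B : 'M[C]_n) :
  \tr (A *t B) = \tr A * \tr B.
Proof.
rewrite /mxtrace sum_mxtens mulr_suml; apply: eq_bigr => i _.
by rewrite mulr_sumr; apply: eq_bigr => j _; rewrite tensmxE.
Qed.

Lemma adjmx_tens m n p q (A : 'M[C]_(m, n)) (B : 'M[C]_(p, q)) :
  (A *t B) ^t* = (A ^t* *t B ^t*).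
Proof. by rewrite trmx_tens map_mxT. Qed.

Lemma tens1mx m n : (1%:M : 'M[C]_m) *t (1%:M : 'M[C]_n) = 1%:M.
Proof.
apply/matrixP => k l; case: (mxtens_indexP k) => i j.
case: (mxtens_indexP l) => i' j'; rewrite tensmxE !mxE -natrM mulnb.
by rewrite (can_eq (@mxtens_indexK m n)) xpair_eqE.
Qed.

Lemma unitarymx_tens m n (A : 'M[C]_m) (B : 'M[C]_n) :
  A \is unitarymx -> B \is unitarymx -> (A *t B) \is unitarymx.
Proof.
move=> Au Bu; apply/unitarymxP.
by rewrite adjmx_tens tensmx_mul !unitarymxl // tens1mx.
Qed.

Definition unvec p n (E : 'M[C]_(p * p, n)) (k : 'I_n) : 'M[C]_p :=
  \matrix_(i, j) E (mxtens_index (i, j)) k.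

(** The conjugate on the second factor becomes an adjoint on the right, so that for [A = B] unitary
    the fixed vectors are the matrices commuting with [A]. *)
Lemma unvec_tensM p n (A B : 'M[C]_p) (E : 'M[C]_(p * p, n)) k :
  unvec ((A *t map_mx Num.conj B) *m E) k = A *m unvec E k *m B ^t*.
Proof.
apply/matrixP => i j; rewrite !mxE sum_mxtens exchange_big; apply: eq_bigr => l _.
rewrite !mxE mulr_suml; apply: eq_bigr => m _.
by rewrite tensmxE !mxE; ring.
Qed.

Lemma unvec_inj p n (E F : 'M[C]_(p * p, n)) :
  (forall k, unvec E k = unvec F k) -> E = F.
Proof.
move=> h; apply/matrixP => l k; case: (mxtens_indexP l) => i j.
by have /matrixP/(_ i j) := h k; rewrite !mxE.
Qed.

Lemma unitarymx_conj p (A : 'M[C]_p) :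
  A \is unitarymx -> map_mx Num.conj A \is unitarymx.
Proof.
move=> Au; apply/unitarymxP.
have /(congr1 (map_mx Num.conj)) := unitarymxl Au.
by rewrite map_mxM map_mx1 map_trmx.
Qed.

(** Multiplicative in [A], with trace |tr A|^2: squared moduli of traces become linear. *)
Definition tensconj p (A : 'M[C]_p) : 'M[C]_(p * p) := A *t map_mx Num.conj A.

Lemma tensconjM p (A B : 'M[C]_p) : tensconj (A *m B) = tensconj A *m tensconj B.
Proof. by rewrite /tensconj map_mxM tensmx_mul. Qed.

Lemma tensconj_unitary p (A : 'M[C]_p) :
  A \is unitarymx -> tensconj A \is unitarymx.
Proof. by move=> Au; apply: unitarymx_tens => //; exact: unitarymx_conj. Qed.

Lemma mxtrace_tensconj p (A : 'M[C]_p) :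
  \tr (tensconj A) = \tr A * ((\tr A)^*)%R.
Proof.
rewrite mxtrace_tens; congr (_ * _).
by rewrite /mxtrace rmorph_sum; apply: eq_bigr => i _; rewrite mxE.
Qed.

Lemma tensconj_fixP p n (A : 'M[C]_p) (E : 'M[C]_(p * p, n)) :
  A \is unitarymx ->
  tensconj A *m E = E <-> forall k, A *m unvec E k = unvec E k *m A.
Proof.
move=> Au; split=> [fE k|cE].
  by rewrite -{2}fE unvec_tensM -!mulmxA unitarymxr // mulmx1.
apply: unvec_inj => k.
by rewrite unvec_tensM cE -mulmxA unitarymxl // mulmx1.
Qed.

Lemma mxtrace_sum I (r : seq I) (P : pred I) p (F : I -> 'M[C]_p) :
  \tr (\sum_(i <- r | P i) F i) = \sum_(i <- r | P i) \tr (F i).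
Proof. exact: raddf_sum. Qed.

End TensorTrace.

Section Separation.
Variables (R : realType).
Local Notation C := (R[i] : numClosedFieldType).
Variables (p : nat) (S : Type) (P : S -> 'M[C]_p) (s0 : S).
Hypothesis P_unitary : forall s, P s \is unitarymx.
Hypothesis PM : forall s t, exists r, P r = P s *m P t.

(* The vectors fixed by all the P s (x) conj (P s) are the commutant of the P s,
   which w commutes with, so that w (x) conj w fixes the mean E too. *)
Lemma bicommutant_mean (w : 'M[C]_p) (L : seq 'M[C]_p) (alpha beta : R) :
  w \is unitarymx ->
  (forall X, (forall s, P s *m X = X *m P s) -> w *m X = X *m w) ->
  (forall s, alpha <= \sum_(A <- L) cabs2 (\tr (A *m P s))) ->
  (forall s, \sum_(A <- L) cabs2 (\tr (A *m w *m P s)) <= beta) ->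
  alpha <= beta.
Proof.
move=> wu wX Ha Hb.
have [||E [fixE meanE]] := @unitary_mean R _ S (fun s => tensconj (P s)) s0.
- by move=> s; exact: (tensconj_unitary (P_unitary s)).
- by move=> s t; have [r er] := PM s t; exists r; rewrite er tensconjM.
have wE : tensconj w *m E = E.
  apply/tensconj_fixP => // k; apply: wX => s.
  exact: (proj1 (tensconj_fixP _ (P_unitary s)) (fixE s)).
pose B := \sum_(A <- L) tensconj A.
have trB M : Re (\tr (B *m tensconj M)) = \sum_(A <- L) cabs2 (\tr (A *m M)).
  rewrite /B mulmx_suml mxtrace_sum Re_sum; apply: eq_bigr => A _.
  by rewrite -tensconjM mxtrace_tensconj.
apply: (@le_trans _ _ (Re (\tr (B *m E)))).
  (* [meanE] transfers upper bounds only, hence the passage to [- B]. *)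
  rewrite -lerN2 -ReN -raddfN -mulNmx; apply: meanE => s.
  by rewrite mulNmx raddfN ReN lerN2 trB.
(* Inserting [tensconj w], which fixes [E], turns [B] into the functional bounded by [beta]. *)
rewrite -wE mulmxA; apply: meanE => s; rewrite -mulmxA -tensconjM trB.
by have := Hb s; under eq_bigr do rewrite -mulmxA.
Qed.

End Separation.

(** * Tannaka duality *)

(** Used for large tensor powers, where one large term must outweigh [M] small ones. It follows from
    the first two terms of the binomial expansion. *)
Lemma geometric_gap (R : realType) (q h : R) (M : nat) : 0 <= q -> 0 < h ->
  exists n, M%:R * q ^+ n.+1 < (q + h) ^+ n.+1.
Proof.
move=> q0 h0.
have bern n : q ^+ n.+1 + n.+1%:R * h * q ^+ n <= (q + h) ^+ n.+1.
  elim: n => [|n IH]; first by rewrite !expr1 expr0; lra.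
  rewrite [leRHS]exprS.
  have qn : 0 <= q ^+ n by apply: exprn_ge0.
  apply: le_trans (ler_wpM2l _ IH); last lra.
  rewrite !(exprS q) -(natr1 n.+1).
  have := mulr_ge0 (mulr_ge0 (ler0n R n.+1) (ltW h0)) (mulr_ge0 (ltW h0) qn).
  by move: (n.+1%:R) (q ^+ n) => k Q; lra.
have [n hn] : exists n : nat, M%:R * q < n%:R * h.
  exists (Num.truncn (M%:R * q / h)).+1; rewrite -ltr_pdivrMr //.
  exact: truncnS_gt.
exists n; move: q0; rewrite le_eqVlt => /orP[/eqP <-|q0].
  by rewrite expr0n mulr0 add0r exprn_gt0.
apply: lt_le_trans (bern n).
have qn : 0 < q ^+ n by apply: exprn_gt0.
rewrite exprS mulrA -(natr1 n).
have := hn; rewrite -(ltr_pM2r qn).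
have := mulr_gt0 h0 qn; have := mulr_gt0 q0 qn.
by move: (n%:R) (q ^+ n) => k Q; lra.
Qed.

(* The library states compact_cover for pointed spaces only. *)
Definition pointed_at (T : topologicalType) (t : T) : Type := T.
HB.instance Definition _ (T : topologicalType) (t : T) :=
  Topological.copy (pointed_at t) T.
HB.instance Definition _ (T : topologicalType) (t : T) :=
  isPointed.Build (pointed_at t) t.

Lemma cover_compact_pointed (T : topologicalType) (t : T) (A : set T) :
  compact A -> cover_compact A.
Proof.
by move=> cA; have /(congr1 (@^~ A)) e := @compact_cover (pointed_at t);
  rewrite -[cover_compact A]/(@cover_compact (pointed_at t) A) -e.
Qed.

Section Tannaka.
Variables (R : realType).
Local Notation C := (R[i] : numClosedFieldType).
Variables (B : starCat C) (TS : symTensor B) (S : topologicalGroupType).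
Variable E : dualEmbedding TS S.
Local Notation I := (emap E).
Local Notation pi := (emb_rep E).
Local Notation J := (emb_J E).

Definition tensor_automorphism (x : forall a, 'M[C]_(edim E a)) : Prop :=
  [/\ forall a, x a \is unitarymx,
      forall a b (f : hom a b), x b *m I f = I f *m x a,
      forall a b, x (tobj TS a b) *m J a b = J a b *m (x a *t x b) &
      x (tunit TS) = 1%:M].

Lemma rep_tensor_automorphism s : tensor_automorphism (fun a => pi a s).
Proof.
split=> [a|a b f|a b|]; first exact: emb_rep_unitary.
- by have /emb_full -> : exists g, I g = I f by exists f.
- exact: emb_rep_tens.
- exact: emb_rep_unit.
Qed.

Lemma tensor_automorphismM x y : tensor_automorphism x ->
  tensor_automorphism y -> tensor_automorphism (fun a => x a *m y a).
Proof.
move=> [xu xn xt x1] [yu yn yt y1]; split=> [a|a b f|a b|].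
- exact: mul_unitarymx.
- by rewrite -mulmxA yn mulmxA xn mulmxA.
- by rewrite -mulmxA yt mulmxA xt -mulmxA tensmx_mul.
- by rewrite x1 y1 mulmx1.
Qed.

Lemma trace_tobj x a b : tensor_automorphism x ->
  \tr (x (tobj TS a b)) = \tr (x a) * \tr (x b).
Proof.
move=> [_ _ xt _]; rewrite -mxtrace_tens.
have [/unitarymxP Ju /unitarymxP] := emb_J_unitary E a b; rewrite adjmxK => Ju'.
by rewrite -[x (tobj _ _ _)]mulmx1 -Ju mulmxA xt mxtrace_mulC mulmxA Ju' mul1mx.
Qed.

(** There are [n.+1] factors: the recursion starts at [a], not at the unit. *)
Fixpoint tpow (a : obj B) (n : nat) : obj B :=
  if n is n'.+1 then tobj TS a (tpow a n') else a.

Lemma trace_tpow x a n : tensor_automorphism x ->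
  \tr (x (tpow a n)) = \tr (x a) ^+ n.+1.
Proof.
move=> hx; elim: n => [|n IH]; first by rewrite expr1.
by rewrite exprS -IH; exact: trace_tobj.
Qed.

Lemma unit_edim_gt0 : (0 < edim E (tunit TS))%N.
Proof.
have [_ /unitarymxP] := emb_J1_unitary E; rewrite adjmxK.
case: (edim E (tunit TS)) (emb_J1 E) => // J1 /matrixP/(_ 0 0)/eqP.
by rewrite !mxE big_ord0 eqxx mulr1n eq_sym oner_eq0.
Qed.

Lemma isometry_mx a b (v : hom a b) : adj v \oc v = idm a ->
  (I v) ^t* *m I v = 1%:M.
Proof. by rewrite -emap_adj -emapM => ->; exact: emap1. Qed.

(* Since sigma contains the unit object, where x is 1, a scalar x sigma is 1. *)
Lemma tensor_automorphism_scalar (x : forall a, 'M[C]_(edim E a)) sigma rho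
    (v : hom (tunit TS) sigma) (w : hom rho sigma) (k : C) :
  tensor_automorphism x -> adj v \oc v = idm (tunit TS) ->
  adj w \oc w = idm rho -> x sigma = k%:M -> x rho = 1%:M.
Proof.
move=> [_ xn _ x1] /isometry_mx vv /isometry_mx ww xk.
have k1 : k = 1.
  have := xn _ _ v; rewrite x1 xk mul_scalar_mx mulmx1.
  move/(congr1 (mulmx ((I v) ^t*))); rewrite -scalemxAr vv.
  have := unit_edim_gt0; case: (edim _ _) => // n _ /matrixP/(_ 0 0).
  by rewrite !mxE eqxx mulr1.
have := xn _ _ w; rewrite xk k1 mul1mx => /(congr1 (mulmx ((I w) ^t*))).
by rewrite ww mulmxA ww mul1mx.
Qed.

Hypothesis cptS : compact [set: S].

Lemma trace_rep_continuous a (A : 'M[C]_(edim E a)) :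
  continuous (fun s => cabs2 (\tr (A *m pi a s))).
Proof.
have ct : continuous (fun s => \tr (A *m pi a s) : C).
  rewrite (_ : (fun s => _) = fun s => \sum_i \sum_j A i j * pi a s j i).
    apply: continuous_sum => i; apply: continuous_sum => j s.
    apply: (cvgM (cvg_cst _)).
    exact: (continuous_comp (@emb_rep_continuous _ _ _ _ E a s)
                            (@coord_continuous _ _ _ j i _)).
  by apply/funext => s; apply: eq_bigr => i _; rewrite mxE.
rewrite (_ : (fun s => _) = fun s => Re (\tr (A *m pi a s)) * Re (\tr (A *m pi a s))
    + Im (\tr (A *m pi a s)) * Im (\tr (A *m pi a s))); last first.
  by apply/funext => s; rewrite cabs2E !expr2.
move=> s.
have cR := continuous_comp (ct s) (@Re_continuous R _).
have cI := continuous_comp (ct s) (@Im_continuous R _).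
exact: (cvgD (cvgM cR cR) (cvgM cI cI)).
Qed.

Lemma tannaka (x : forall a, 'M[C]_(edim E a)) rho sigma
    (v : hom (tunit TS) sigma) (w : hom rho sigma) :
  adj v \oc v = idm (tunit TS) -> adj w \oc w = idm rho ->
  tensor_automorphism x -> exists s, pi rho s = x rho.
Proof.
move=> vv ww hx; apply: contrapT => nx.
set D : R := (edim E sigma)%:R.
have D0 : (0 < edim E sigma)%N.
  case: posnP => // e; have := isometry_mx vv; have := unit_edim_gt0.
  case: (edim E (tunit TS)) (I v) => // n V _ /matrixP/(_ 0 0)/eqP.
  rewrite !mxE big1 ?eqxx ?mulr1n 1?eq_sym ?oner_eq0 // => i.
  by case: i => i hi; exfalso; move: hi; rewrite e.
pose y s a := x a *m pi a s.
have hy s : tensor_automorphism (y s).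
  exact: tensor_automorphismM hx (rep_tensor_automorphism s).
(* Were the trace maximal, [y s] would be scalar at [sigma], hence 1 at [rho], and [x rho] would be
   the image of the inverse of [s]. *)
have lt_y s : cabs2 (\tr (y s sigma)) < D ^+ 2.
  have [yu _ _ _] := hy s.
  rewrite lt_neqAle cabs2_trace_le // andbT; apply/negP => /eqP.
  move=> /(cabs2_trace_eq D0 (yu sigma))[k yk].
  have y1 := tensor_automorphism_scalar (hy s) vv ww yk.
  apply: nx; exists s^-1%g; rewrite -[LHS]mul1mx -y1 /y -mulmxA -emb_repM.
  by rewrite mulgV emb_rep1 mulmx1.
(* Compactness makes the strict inequality uniform in [s]. *)
have [s0 _ max_y] := compact_EVT_max
  (ex_intro _ 1%g Logic.I : [set: S] !=set0) cptS
  (continuous_subspaceT (@trace_rep_continuous sigma (x sigma))).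
set q := cabs2 (\tr (y s0 sigma)).
have le_q s : cabs2 (\tr (y s sigma)) <= q by apply: max_y; rewrite in_setT.
have q0 : 0 <= q by exact: cabs2_ge0.
(* [q + h] is the midpoint of [q] and [D ^+ 2], so that [near t] contains [t], where the squared
   trace is [D ^+ 2]. *)
pose h := (D ^+ 2 - q) / 2.
have h0 : 0 < h by rewrite divr_gt0 // subr_gt0 lt_y.
pose near t : set S :=
  [set s | q + h < cabs2 (\tr (pi sigma t^-1%g *m pi sigma s))].
have near_open t : open (near t).
  have /continuousP ct := @trace_rep_continuous sigma (pi sigma t^-1%g).
  exact: (ct _ (@open_gt R (q + h))).
have /(_ S setT near) := cover_compact_pointed 1%g cptS.
case=> [t _|t _|T _ coverT]; first exact: near_open.
  exists t => //; rewrite /near /= -emb_repM mulVg emb_rep1 mxtrace1.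
  have -> : cabs2 ((edim E sigma)%:R : C) = D ^+ 2.
    by rewrite cabs2E -(rmorph_nat (real_complex R)) /= expr0n addr0.
  by have := lt_y s0; rewrite -/q /h; lra.
have [n] := geometric_gap (size (finmap.enum_fset T)) q0 h0.
(* The functional attached to the net is large on the group and small on its translate by [x];
   [bicommutant_mean] gives the opposite inequality. *)
rewrite ltNge => /negP; apply.
have [xu xn _ _] := hx; set c := tpow sigma n.
apply: (@bicommutant_mean R _ _ (pi c) 1%g _ _ (x c)
         [seq pi c t^-1%g | t <- finmap.enum_fset T]) => //.
- by move=> s; exact: emb_rep_unitary.
- by move=> s t; exists (s * t)%g; exact: emb_repM.
(* By fullness [X] is the image of an arrow, with which [x] commutes by naturality. *)
- move=> X hX; have [s|f <-] := proj1 (@emb_full _ _ _ _ E c c X);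
    last exact: xn.
  by rewrite hX.
(* Some element of the net has [s] nearby, and its term alone suffices. *)
- move=> s; rewrite big_map.
  have [t tT st] := coverT s Logic.I.
  rewrite (bigD1_seq t) ?finmap.fset_uniq //=; apply: ler_wpDr.
    by apply: sumr_ge0 => r _; exact: cabs2_ge0.
  rewrite -emb_repM (trace_tpow _ _ (rep_tensor_automorphism _)) cabs2X.
  have qh0 : 0 <= q + h by rewrite addr_ge0 // ltW.
  by rewrite lerXn2r ?nnegrE ?cabs2_ge0 // emb_repM ltW.
- move=> s; rewrite big_map.
  have le_term t : cabs2 (\tr (pi c t^-1%g *m x c *m pi c s)) <= q ^+ n.+1.
    (* Cyclicity of the trace makes this a trace of [y (s * t^-1)]. *)
    rewrite -mulmxA mxtrace_mulC -mulmxA -emb_repM.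
    rewrite (trace_tpow _ _ (hy (s * t^-1)%g)) cabs2X.
    by rewrite lerXn2r ?nnegrE ?cabs2_ge0.
  apply: (le_trans (ler_sum _ (fun t _ => le_term t))).
  by rewrite big_const_seq count_predT iter_addr addr0 mulr_natl.
Qed.

End Tannaka.

(** * Holonomy *)

Section Transport.
Variables (disp : Order.disp_t) (K : porderType disp) (C : numClosedFieldType).
Variables (T : symTensorPresheaf K C) (bundleT : beta_bundle T).
Variables (r s : secobj T).
Implicit Types o x : K.

Lemma beta_res_res o o' o'' (h : (o <= o')%O) (h' : (o' <= o'')%O)
    (h'' : (o <= o'')%O) (f : bhom o'' r s) :
  beta_res bundleT h (beta_res bundleT h' f) = beta_res bundleT h'' f.
Proof. by apply: val_inj; exact: sres_sres. Qed.

(** For an arrow that extends to some [x] above the support, the step is computed by restrictions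
    alone, without the chosen [beta_ext]. *)
Lemma beta_step_res b x (i : (supp b <= x)%O) (h0 : (d0 b <= x)%O)
    (h1 : (d1 b <= x)%O) (k : bhom x r s) :
  beta_step bundleT (beta_res bundleT h1 k) = beta_res bundleT h0 k.
Proof.
by rewrite /beta_step -(beta_res_res (d1_le b) i) beta_resK beta_res_res.
Qed.

Lemma ecast_beta_res o o' x (e : o = o') (h : (o <= x)%O) (h' : (o' <= x)%O)
    (k : bhom x r s) :
  ecast z (bhom z r s) e (beta_res bundleT h k) = beta_res bundleT h' k.
Proof. by case: _ / e h' => h' /=; rewrite (bool_irrelevance h h'). Qed.

Lemma transport_irr p o o' (h h' : chain o o' p) (f : bhom o r s) :
  transport bundleT h f = transport bundleT h' f.
Proof. by rewrite (bool_irrelevance h h'). Qed.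

Lemma transport_end p o o1 o2 (e : o1 = o2) (h1 : chain o o1 p)
    (h2 : chain o o2 p) (f : bhom o r s) :
  transport bundleT h2 f = ecast z (bhom z r s) e (transport bundleT h1 f).
Proof. by case: _ / e h2 => h2; exact: transport_irr. Qed.

Lemma transport_cat p q o o' o'' (h : chain o o'' (p ++ q))
    (hp : chain o' o'' p) (hq : chain o o' q) (f : bhom o r s) :
  transport bundleT h f = transport bundleT hp (transport bundleT hq f).
Proof.
elim: p => [|b p IH] /= in o'' h hp *; first exact: transport_end.
rewrite (eq_irrelevance (eqP (proj1 (andP h))) (eqP (proj1 (andP hp)))).
by rewrite (IH _ _ (proj2 (andP hp))).
Qed.

Lemma beta_step_surj b (g : bhom (d0 b) r s) :
  exists f : bhom (d1 b) r s, beta_step bundleT f = g.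
Proof.
exists (beta_res bundleT (d1_le b) (beta_ext bundleT (d0_le b) g)).
by rewrite /beta_step beta_resK beta_extK.
Qed.

Lemma ecast_surj o o' (e : o = o') (g : bhom o' r s) :
  exists f, ecast z (bhom z r s) e f = g.
Proof. by case: _ / e g => g; exists g. Qed.

(** Every arrow is a transported one, as the naturality of right quotients requires. *)
Lemma transport_surj p o o' (h : chain o o' p) (g : bhom o' r s) :
  exists f : bhom o r s, transport bundleT h f = g.
Proof.
elim: p => [|b p IH] /= in o' h g *.
  exact: ecast_surj.
have [g' <-] := ecast_surj (eqP (proj1 (andP h))) g.
have [f <-] := beta_step_surj g'.
by have [f' <-] := IH _ (proj2 (andP h)) f; exists f'.
Qed.

(* Both sides of the 2-simplex extend the same arrow to its support. *)
Lemma transport_elementary p q o o' (h : chain o o' p) (h' : chain o o' q)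
    (f : bhom o r s) :
  elementary p q -> transport bundleT h f = transport bundleT h' f.
Proof.
move=> pq; case: _ / pq h h' => p' q' c h h'.
have [z hp /= /andP[e1 hq]] := chain_catE h.
have hs : chain o z (f1 c :: q') by rewrite /= e1.
have hs' : chain o z (f0 c :: f2 c :: q').
  by rewrite /= f001 e1 f102 eqxx -f112.
rewrite (transport_cat h hp hs) (transport_cat h' hp hs'); congr transport.
rewrite /=.
set g1 := transport _ _ f; set g2 := transport _ _ f.
have -> : g2 = ecast z (bhom z r s) (f112 c) g1 by exact: transport_end.
have le1 : (d1 (f1 c) <= supp2 c)%O := le_trans (d1_le _) (f1_le c).
have [k ek] := beta_res_surj bundleT le1 g1.
have le2 : (d1 (f2 c) <= supp2 c)%O := le_trans (d1_le _) (f2_le c).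
have le3 : (d0 (f2 c) <= supp2 c)%O := le_trans (d0_le _) (f2_le c).
have le4 : (d1 (f0 c) <= supp2 c)%O := le_trans (d1_le _) (f0_le c).
have le5 : (d0 (f0 c) <= supp2 c)%O := le_trans (d0_le _) (f0_le c).
have le6 : (d0 (f1 c) <= supp2 c)%O := le_trans (d0_le _) (f1_le c).
have le7 : (z <= supp2 c)%O by rewrite -(eqP e1).
rewrite -ek (ecast_beta_res _ _ le2) (beta_step_res (f1_le c) le6).
rewrite (beta_step_res (f2_le c) le3) (ecast_beta_res _ _ le4).
by rewrite (beta_step_res (f0_le c) le5) !(ecast_beta_res _ _ le7).
Qed.

Lemma transport_homotopic p q o o' (h : chain o o' p) (h' : chain o o' q)
    (f : bhom o r s) :
  seq_homotopic p q -> transport bundleT h f = transport bundleT h' f.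
Proof.
move=> pq; elim: pq h h' => [x y xy|x|x y _ IH|x y z xy IH1 _ IH2] h h'.
- exact: transport_elementary.
- exact: transport_irr.
- by symmetry.
(* Homotopy keeps the ends, so transport along the intermediate sequence makes sense. *)
- have hy : chain o o' y by rewrite -(homotopic_chain _ _ xy).
  by rewrite (IH1 h hy) (IH2 hy h').
Qed.

End Transport.

(** * Unitary natural transformations and their quotients *)

Section Transformations.
Variables (R : realType).
Local Notation C := (R[i] : numClosedFieldType).
Variables (B : starCat C) (TS : symTensor B) (S : topologicalGroupType).
Variable E : dualEmbedding TS S.
Local Notation I := (emap E).
Local Notation J := (emb_J E).
Implicit Types F G : forall a b : obj B, hom a b -> hom a b.

Definition transf_comp F G (U : unitaryTransf E F) (V : unitaryTransf E G) :
  unitaryTransf E (fun a b f => F a b (G a b f)).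
Proof.
exists (fun a => U a *m V a) => [a|a b f|a b|].
- by apply: mul_unitarymx; exact: transf_unitary.
- by rewrite -mulmxA transf_nat mulmxA transf_nat mulmxA.
- by rewrite -mulmxA transf_tens mulmxA transf_tens -mulmxA tensmx_mul.
- by rewrite !transf_unit mulmx1.
Defined.

Definition transf_ext F G (U : unitaryTransf E F)
  (FG : forall a b f, F a b f = G a b f) : unitaryTransf E G.
Proof.
exists U => [a|a b f|a b|]; first exact: transf_unitary.
- by rewrite -FG; exact: transf_nat.
- exact: transf_tens.
- exact: transf_unit.
Defined.

Definition rep_transf (s : S) : unitaryTransf E (fun a b f => f).
Proof.
exists (fun a => emb_rep E a s); by case: (rep_tensor_automorphism E s).
Defined.

Lemma adj_transf_tens F (U : unitaryTransf E F) a b :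
  (U (tobj TS a b)) ^t* *m J a b = J a b *m ((U a) ^t* *t (U b) ^t*).
Proof.
have {1}-> : J a b = U (tobj TS a b) *m J a b *m ((U a) ^t* *t (U b) ^t*).
  rewrite transf_tens -mulmxA tensmx_mul !unitarymxl ?transf_unitary //.
  by rewrite tens1mx mulmx1.
by rewrite !mulmxA unitarymxr ?transf_unitary // mul1mx.
Qed.

Lemma adj_transf_unit F (U : unitaryTransf E F) : (U (tunit TS)) ^t* = 1%:M.
Proof. by rewrite transf_unit adjmx1. Qed.

Lemma adj_transf_nat F (U : unitaryTransf E F) a b (f : hom a b) :
  (U b) ^t* *m I (F a b f) = I f *m (U a) ^t*.
Proof.
rewrite -[LHS]mulmx1 -(unitarymxl (transf_unitary U a)) !mulmxA.
rewrite -(mulmxA _ (I _)) -transf_nat mulmxA unitarymxr ?transf_unitary //.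
by rewrite mul1mx.
Qed.

(** [U] and [V] both lead from [E] to [E] after [F]: going along [V] and back along [U] is an
    automorphism of [E]. *)
Lemma left_quotient_automorphism F (U V : unitaryTransf E F) :
  tensor_automorphism (E := E) (fun a => (U a) ^t* *m V a).
Proof.
split=> [a|a b f|a b|].
- by rewrite mul_unitarymx ?trmxC_unitary ?transf_unitary.
- by rewrite -mulmxA transf_nat mulmxA adj_transf_nat mulmxA.
- by rewrite -mulmxA transf_tens mulmxA adj_transf_tens -mulmxA tensmx_mul.
- by rewrite adj_transf_unit transf_unit mulmx1.
Qed.

(** This composite is natural on the arrows in the image of [F], hence on all arrows when [F] is
    surjective. *)
Lemma right_quotient_automorphism F (U V : unitaryTransf E F) :
  (forall a b (g : hom a b), exists f, F a b f = g) ->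
  tensor_automorphism (E := E) (fun a => V a *m (U a) ^t*).
Proof.
move=> Fsurj; split=> [a|a b g|a b|].
- by rewrite mul_unitarymx ?trmxC_unitary ?transf_unitary.
- have [f <-] := Fsurj a b g.
  by rewrite -mulmxA adj_transf_nat mulmxA transf_nat mulmxA.
- by rewrite -mulmxA adj_transf_tens mulmxA transf_tens -mulmxA tensmx_mul.
- by rewrite adj_transf_unit transf_unit mulmx1.
Qed.

Hypothesis cptS : compact [set: S].
Variables (rho sigma : obj B) (v : hom (tunit TS) sigma) (w : hom rho sigma).
Hypothesis vv : adj v \oc v = idm (tunit TS).
Hypothesis ww : adj w \oc w = idm rho.
Local Notation Grho := (image_group E cptS rho).

Lemma transf_quotient F (U V : unitaryTransf E F) :
  Grho ((U rho) ^t* *m V rho).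
Proof.
have [s es] := tannaka cptS vv ww (left_quotient_automorphism U V).
by exists s.
Qed.

Lemma transf_normalizes F (U : unitaryTransf E F) :
  (forall a b (g : hom a b), exists f, F a b f = g) ->
  normalizes Grho (U rho).
Proof.
move=> Fsurj; apply/normalizesP; split; first exact: transf_unitary.
have Uu := transf_unitary U rho.
move=> M; split=> [[s <-]|[s es]].
  (* The conjugate of [s] by [U] is the right quotient of [U s] by [U]. *)
  have [t et] := tannaka cptS vv ww
    (right_quotient_automorphism U (transf_comp U (rep_transf s)) Fsurj).
  by exists t.
(* Conversely, [M] is the left quotient of [s U] by [U]. *)
have := transf_quotient U (transf_comp (rep_transf s) U).
rewrite /= es -(mulmxA (U rho)) !mulmxA unitarymxr // mul1mx.
by rewrite -mulmxA unitarymxr // mulmx1.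
Qed.

End Transformations.

Section Holonomy.
Variables (R : realType) (disp : Order.disp_t) (K : porderType disp).
Local Notation C := (R[i] : numClosedFieldType).
Variables (T : symTensorPresheaf K C) (rho : secobj T) (a : K).

(** The object that [tannaka] asks for is the direct sum of the unit and [rho] in the section
    category, with its isometries evaluated at [a]. *)
Lemma DR_unit_sum : DR_presheaf T -> exists (sigma : secobj T)
    (v : @Defs.hom C (beta_cat T a) (sec_tunit T) sigma)
    (w : @Defs.hom C (beta_cat T a) rho sigma),
  adj v \oc v = idm (sec_tunit T : obj (beta_cat T a)) /\
  adj w \oc w = idm (rho : obj (beta_cat T a)).
Proof.
case=> _ _ sums _; have [sigma [v [w [ev ew _]]]] := sums (sec_tunit T) rho.
have eval r (f : secarr r sigma) : phi (f a).
  by exists (fun o _ => f o); split=> // o o' h h' i; exact: sarrE.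
exists sigma, (mkbhom (eval _ v)), (mkbhom (eval _ w)).
split; apply: val_inj.
  exact: (congr1 (fun f : secarr _ _ => f a) ev).
exact: (congr1 (fun f : secarr _ _ => f a) ew).
Qed.

Variable (bundleT : beta_bundle T).
Variables (S : topologicalGroupType) (compactS : compact [set: S]).
Variable (E : dualEmbedding (beta_tensor T a) S).
Variable (u : forall l : kpath a a, unitaryTransf E (holonomy_aut bundleT l)).
Hypothesis drT : DR_presheaf T.
Local Notation G := (image_group E compactS rho).

Lemma holonomy_normalizes l : normalizes G (u l rho).
Proof.
have [sigma [v [w [vv ww]]]] := DR_unit_sum drT.
have surj r s (g : hom r s) : exists f, holonomy_aut bundleT l f = g.
  exact: transport_surj.
exact (@transf_normalizes R (beta_cat T a) _ _ E compactS rho sigma v w vv ww _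
  (u l) surj).
Qed.

Definition holonomy_unitary (l : kpath a a) : normalizer G :=
  Sub (u l rho) (holonomy_normalizes l).

(** Common source of homotopy invariance and multiplicativity: the class modulo [G] depends only on
    the action on arrows. *)
Lemma holonomy_unitary_quotient l
    (F : forall r s : obj (beta_cat T a), hom r s -> hom r s)
    (V : unitaryTransf E F) (N : normalizer G) :
  (forall r s f, F r s f = holonomy_aut bundleT l f) -> val N = V rho ->
  outer_proj G (holonomy_unitary l) = outer_proj G N.
Proof.
move=> FE NV; have [sigma [v [w [vv ww]]]] := DR_unit_sum drT.
apply/qprojP; rewrite /= /in_group /= NV.
exact (@transf_quotient R (beta_cat T a) _ _ E compactS rho sigma v w vv ww _
  (u l) (transf_ext V FE)).
Qed.

Lemma holonomy_homotopic l l' : homotopic l l' ->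
  outer_proj G (holonomy_unitary l) = outer_proj G (holonomy_unitary l').
Proof.
move=> ll'; apply: (holonomy_unitary_quotient (V := u l')) => // r s f.
exact/transport_homotopic/seq_homotopic_sym.
Qed.

Lemma holonomy_comp l l' :
  outer_proj G (holonomy_unitary (path_comp l l')) =
  outer_proj G (holonomy_unitary l * holonomy_unitary l')%g.
Proof.
apply: (holonomy_unitary_quotient (V := transf_comp (u l) (u l'))) => // r s f.
by symmetry; exact: transport_cat.
Qed.

Lemma holonomy_morphism : exists chi : {multiplicative pi1 a -> outer G},
  forall l : kpath a a, chi (pclass l) = outer_proj G (holonomy_unitary l).
Proof.
pose chi (x : pi1 a) : outer G := outer_proj G (holonomy_unitary (repr x)).
have chiE l : chi (pclass l) = outer_proj G (holonomy_unitary l).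
  by apply: holonomy_homotopic; apply/pclassP; exact: pclass_repr.
have chiM : {morph chi : x y / (x * y)%g}.
  move=> x y; rewrite -(pclass_repr x) -(pclass_repr y).
  rewrite -[(_ * _)%g in LHS]/(pi1_mul _ _) pclass_comp !chiE holonomy_comp.
  exact: qproj_morph.
pose M := isMultiplicative.Build _ _ chi chiM.
by exists (HB.pack_for {multiplicative pi1 a -> outer G} chi M).
Qed.

End Holonomy.

(** * Cocycles and lifts *)

Section Cocycles.
Variables (disp : Order.disp_t) (K : porderType disp) (N : groupType).
Implicit Types (z : simplex1 K -> N) (s t : seq (simplex1 K)).

(** A form of [along] free of endpoints, since homotopies and inductions run over bare sequences. *)
Definition seq_along z s : N := (\prod_(b <- s) z b)%g.

Lemma seq_along_cat z s t : seq_along z (s ++ t) = (seq_along z s * seq_along z t)%g.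
Proof. exact: big_cat. Qed.

Lemma seq_along1 z b : seq_along z [:: b] = z b.
Proof. by rewrite /seq_along big_seq1. Qed.

Lemma cocycleE z : cocycle z -> forall c, z (f1 c) = (z (f0 c) * z (f2 c))%g.
Proof. by move=> hz c; have /mulg1_eq /invg_inj := hz c. Qed.

(** The cocycle identity is invariance under an elementary deformation. *)
Lemma seq_along_homotopic z s t : cocycle z -> seq_homotopic s t ->
  seq_along z s = seq_along z t.
Proof.
move=> hz; elim=> // [x y [p q c]|x y w _ -> _ ->//].
rewrite !seq_along_cat; congr (_ * _)%g.
by rewrite /seq_along !big_cons mulgA -cocycleE.
Qed.

Lemma cocycle_degen z o : cocycle z -> z (degen o) = 1%g.
Proof.
move=> hz; pose c := @Simplex2 _ _ (degen o) (degen o) (degen o) o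
  (lexx _) (lexx _) (lexx _) erefl erefl erefl.
by have := hz c; rewrite /cobound /= mulgK.
Qed.

Lemma along_path_rev z o o' (p : kpath o o') : cocycle z ->
  along z (path_rev p) = (along z p)^-1%g.
Proof.
move=> hz; apply: invg_inj.
have h : (along z (path_rev p) * along z p = 1)%g.
  rewrite -[LHS](seq_along_cat z) (seq_along_homotopic hz (path_revV (valP p))).
  by rewrite seq_along1 cocycle_degen.
by rewrite (mulg1_eq h) invgK.
Qed.

Lemma seq_along_gauge z z' (w : K -> N) :
  (forall b, z' b = w (d0 b) * z b * (w (d1 b))^-1)%g ->
  forall s o o', chain o o' s ->
  seq_along z' s = (w o' * seq_along z s * (w o)^-1)%g.
Proof.
move=> hz'; elim=> [|b s IH] o o' /=.
  by move/eqP->; rewrite /seq_along !big_nil mulg1 mulgV.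
case/andP=> /eqP <- /IH; rewrite /seq_along !big_cons => ->.
by rewrite hz' !mulgA mulgVK.
Qed.

End Cocycles.

Lemma homotopic_cancel_rev (disp : Order.disp_t) (K : porderType disp)
    (x o o' : K) (p : kpath o o') (s : seq (simplex1 K)) :
  is_path x o s -> seq_homotopic (val (path_rev p) ++ val p ++ s) s.
Proof.
move=> hs; rewrite catA; apply: seq_homotopic_trans (path_degen_l hs).
exact: (seq_homotopic_cat (path_revV (valP p)) (seq_homotopic_refl _)).
Qed.

(** * The cocycle of a path frame in the fundamental group *)

Section Frame.
Variables (disp : Order.disp_t) (K : porderType disp) (a : K).
Variable fr : path_frame a.

Definition frame_class (b : simplex1 K) : pi1 a := pclass (frame_loop fr b).

Lemma along_frame_class o o' (p : kpath o o') : along frame_class p =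
  pclass (path_comp (fr o') (path_comp p (path_rev (fr o)))).
Proof.
case: p => s hs; rewrite /along /=.
elim: s o' hs => [//|b s IH] o' hs.
case/andP: (hs) => _ /= /andP[/eqP e0 h]; case: _ / e0 hs => hs.
(* Paths are nonempty, so the induction starts from a single simplex. *)
rewrite big_cons; case: s => [|b' s] in IH hs h *.
  move/eqP: h => e; rewrite big_nil mulg1.
  by congr pclass; apply: val_inj; rewrite /= e.
have h' : is_path o (d1 b) (b' :: s) by [].
rewrite (IH _ h') -[LHS]/(pi1_mul _ _) pclass_comp; apply/pclassP.
rewrite /homotopic /= -!catA /=.
apply: seq_homotopic_cat; first exact: seq_homotopic_refl.
apply: (@seq_homotopic_cat _ _ [:: b] [:: b]); first exact: seq_homotopic_refl.
(* The frame path of the shared vertex, run out and back, cancels. *)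
by apply: (@homotopic_cancel_rev _ _ a);
  exact: (path_comp_subproof (Sub _ h' : kpath _ _) (path_rev (fr o))).
Qed.

Lemma frame_class_cocycle : cocycle frame_class.
Proof.
move=> c; have h1 : is_path (d1 (f1 c)) (d0 (f1 c)) [:: f1 c].
  by rewrite /is_path /= !eqxx.
have h2 : is_path (d1 (f1 c)) (d0 (f1 c)) [:: f0 c; f2 c].
  by rewrite /is_path /= f001 f102 f112 !eqxx.
have := along_frame_class (Sub _ h1 : kpath _ _).
have := along_frame_class (Sub _ h2 : kpath _ _).
rewrite /along /= !big_cons !big_nil !mulg1 /cobound => -> ->.
apply/eqP; rewrite -(mulgV (pclass (path_comp (fr (d0 (f1 c)))
  (path_comp (Sub [:: f1 c] h1) (path_rev (fr (d1 (f1 c)))))))).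
apply/eqP; congr (_ * _)%g; apply/pclassP.
apply: seq_homotopic_ctx; apply: seq_homotopic_sym.
exact: (elementary_homotopic [::] [::] c).
Qed.

(* The loop fr a at the base point need not be trivial: hence the conjugation. *)
Lemma frame_conj_class (l : kpath a a) :
  along frame_class (path_comp (path_rev (fr a)) (path_comp l (fr a))) =
  pclass l.
Proof.
have pM p q : pclass (path_comp p q) = (pclass p * pclass q)%g :> pi1 a.
  by rewrite -pclass_comp.
have pV p : pclass (path_rev p) = (pclass p)^-1%g :> pi1 a by rewrite -pclass_rev.
by rewrite along_frame_class !pM !pV !mulgA mulgV mul1g mulgK.
Qed.

Lemma conj_cohomologous (N : groupType) (z z' : simplex1 K -> N) (k : N) :
  cocycle z -> cocycle z' ->
  (forall l : kpath a a, let l' := path_comp (path_rev (fr a)) (path_comp l (fr a)) in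
    along z' l' = (k * along z l' * k^-1)%g) ->
  exists w : K -> N, w a = k /\
    forall b, z' b = (w (d0 b) * z b * (w (d1 b))^-1)%g.
Proof.
move=> hz hz' conjz.
pose A o := along z (path_rev (fr o)); pose A' o := along z' (path_rev (fr o)).
(* Gauge equivalence along the frame paths forces [w o] to be [A' o * k * (A o)^-1]; the factors at
   [a] give [w a = k] by cancellation, although [fr a] may be nontrivial. *)
exists (fun o => A' o * (A' a)^-1 * k * A a * (A o)^-1)%g; split.
  by rewrite mulgV mul1g mulgK.
move=> b.
have along_loop (y : simplex1 K -> N) (hy : cocycle y) :
    along y (path_comp (path_rev (fr a)) (path_comp (frame_loop fr b) (fr a))) =
    (along y (path_rev (fr a)) * (along y (path_rev (fr (d0 b))))^-1 * y b *
     along y (path_rev (fr (d1 b))) * (along y (path_rev (fr a)))^-1)%g.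
  rewrite !(along_path_rev _ hy) !invgK /along /= !(big_cat, big_cons) /=.
  by rewrite -![(\prod_(j <- rev _) _)%g]/(along y (path_rev _))
    !(along_path_rev _ hy) !mulgA.
have := conjz (frame_loop fr b).
rewrite /= !along_loop // -!/(A _) -!/(A' _).
move/(congr1 (fun x => A' (d0 b) * (A' a)^-1 * x * A' a * (A' (d1 b))^-1)%g).
rewrite !invgM !invgK !mulgA !mulgVK mulgV mul1g mulgK.
exact.
Qed.

End Frame.

(** * Lifts of the holonomy and classes of cocycles *)

Section Lifts.
Variables (disp : Order.disp_t) (K : porderType disp) (a : K).
Variables (C : numClosedFieldType) (d : nat) (G : compactUnitaryGroup C d).
Variables (ub : simplex1 K -> normalizer G) (fr : path_frame a).
Variable chi : pi1 a -> outer G.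
Hypothesis chiM : {morph chi : x y / (x * y)%g}.
Hypothesis chi_ub : forall b, outer_proj G (ub b) = chi (frame_class fr b).
Local Notation q := (outer_proj G).
Local Notation loop_at_base l :=
  (path_comp (path_rev (fr a)) (path_comp l (fr a))).

Lemma morph_seq_along (H N : groupType) (f : H -> N)
    (fM : {morph f : x y / (x * y)%g}) (z : simplex1 K -> H) s :
  f (seq_along z s) = seq_along (f \o z) s.
Proof.
have f1 : f 1%g = 1%g.
  by apply: (mulgI (f 1%g)); rewrite -fM !mulg1.
by rewrite /seq_along (big_morph f fM f1).
Qed.

Lemma morphV (H N : groupType) (f : H -> N)
    (fM : {morph f : x y / (x * y)%g}) x : f x^-1%g = (f x)^-1%g.
Proof.
have f1 : f 1%g = 1%g.
  by apply: (mulgI (f 1%g)); rewrite -fM !mulg1.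
by symmetry; apply: mulg1_eq; rewrite -fM mulgV.
Qed.

Lemma morph_cocycle (H N : groupType) (f : H -> N)
    (fM : {morph f : x y / (x * y)%g}) (z : simplex1 K -> H) :
  cocycle z -> cocycle (f \o z).
Proof.
move=> hz c; rewrite /cobound /= -(morphV fM) -!fM.
rewrite -[X in f X]/(cobound z c) hz.
by apply: (mulgI (f 1%g)); rewrite -fM !mulg1.
Qed.

Lemma in_groupP (x : normalizer G) : in_group x <-> q x = 1%g.
Proof.
have := qprojP (group_normal G) 1%g x; rewrite /= invg1 mul1g => h.
by split=> [/h <-|e]; [|apply/h; rewrite e].
Qed.

(** Modulo [G] the cochain is the image under [chi] of the cocycle [frame_class]. *)
Lemma cobound_in_group c : in_group (cobound ub c).
Proof.
apply/in_groupP; have := morph_cocycle chiM (frame_class_cocycle fr) c.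
by rewrite /cobound !qproj_morph (morphV (@qproj_morph _ _)) !chi_ub.
Qed.

(** Modulo [G] the factor [g] disappears and [v] acts as a gauge transformation. *)
Lemma proj_twist (p : pairs K G) b : in_group (p.2 b) ->
  q (twist ub p b) =
  (q (p.1 (d0 b)) * chi (frame_class fr b) * (q (p.1 (d1 b)))^-1)%g.
Proof.
move=> /in_groupP gb; rewrite /twist !qproj_morph (morphV (@qproj_morph _ _)).
by rewrite gb mulg1 chi_ub.
Qed.

(** Cocycles are constant on homotopy classes, so the formula of [defines_lift] descends to
    [pi1 a]. *)
Lemma admissible_lift (p : pairs K G) : admissible ub p ->
  exists2 L, is_lift chi L & defines_lift ub fr p L.
Proof.
move=> [pG pz].
pose m l : normalizer G :=
  ((p.1 a)^-1 * along (twist ub p) (loop_at_base l) * p.1 a)%g.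
have mh l l' : homotopic l l' -> m l = m l'.
  move=> ll'; rewrite /m; congr (_ * _ * _)%g.
  apply: (seq_along_homotopic pz).
  by apply: seq_homotopic_ctx; exact: ll'.
have mE (l : kpath a a) : m (repr (pclass l)) = m l.
  by apply: mh; apply/pclassP; exact: pclass_repr.
exists (fun x => m (repr x)) => [|l]; last exact: mE.
split=> [x y|x].
  rewrite -(pclass_repr x) -(pclass_repr y) -[(_ * _)%g in LHS]/(pi1_mul _ _).
  rewrite pclass_comp !mE /m.
  have lM l l' : along (twist ub p) (loop_at_base (path_comp l l')) =
      (along (twist ub p) (loop_at_base l) *
       along (twist ub p) (loop_at_base l'))%g.
    rewrite -[RHS](seq_along_cat (twist ub p)); apply: (seq_along_homotopic pz).
    rewrite /= -!catA; do 2!(apply: seq_homotopic_cat; first exact: seq_homotopic_refl).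
    apply: seq_homotopic_sym.
    (* Between the two loops, [fr a] and its reverse cancel. *)
    have := path_revV (valP (path_rev (fr a))).
    rewrite /= map_rev map_srevK revK catA => h.
    apply: seq_homotopic_trans (path_degen_l (valP (path_comp l' (fr a)))).
    exact: (seq_homotopic_cat h (seq_homotopic_refl _)).
  by rewrite lM !mulgA mulgK.
rewrite /m -{2}(pclass_repr x) -(frame_conj_class fr (repr x)).
set l := loop_at_base _.
rewrite !qproj_morph (morphV (@qproj_morph _ _)).
rewrite [X in (_ * X * _)%g](morph_seq_along (@qproj_morph _ _)).
(* The gauge factors telescope to a conjugation by [q (p.1 a)], which the outer conjugation
   undoes. *)
rewrite (@seq_along_gauge _ _ _ (chi \o frame_class fr) (q \o twist ub p)
  (q \o p.1) (fun b => proj_twist (pG b)) _ _ _ (path_chain l)).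
by rewrite [RHS](morph_seq_along chiM) -!mulgA mulVg mulg1 mulKg.
Qed.

Lemma lift_admissible L : is_lift chi L ->
  exists2 p, admissible ub p & defines_lift ub fr p L.
Proof.
(* With [v = 1], this [g] turns the twisted cochain into [L] applied to [frame_class]; it lies in
   [G] because [L] and [ub] have the same projection. *)
move=> [LM Lq].
pose p : pairs K G := (fun=> 1%g, fun b => L (frame_class fr b) * (ub b)^-1)%g.
have tp : twist ub p =1 L \o frame_class fr.
  by move=> b; rewrite /twist /= mul1g invg1 mulg1 mulgVK.
exists p; last first.
  move=> l; rewrite /= invg1 mul1g mulg1 -{1}(frame_conj_class fr l).
  rewrite (morph_seq_along LM); apply: eq_bigr => b _; by rewrite tp.
split=> [b|c].
  by apply/in_groupP; rewrite qproj_morph (morphV (@qproj_morph _ _)) Lq chi_ub mulgV.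
by rewrite /cobound !tp; exact: (morph_cocycle LM (frame_class_cocycle fr)).
Qed.

(** The value of [w] at [a] accounts for the change of conjugating factor from [p.1 a] to [p'.1 a];
    the converse is [conj_cohomologous]. *)
Lemma equivalent_lift p p' L : admissible ub p -> admissible ub p' ->
  defines_lift ub fr p L -> equivalent a ub p p' <-> defines_lift ub fr p' L.
Proof.
move=> [_ pz] [_ pz'] Lp; split=> [[w [wa hw]] l|Lp'].
  rewrite Lp [along (twist ub p') _](seq_along_gauge hw (path_chain _)) wa.
  by rewrite invgM invgK !mulgA mulVg mul1g mulgVK.
apply: (@conj_cohomologous _ _ _ fr _ _ _ _ pz pz') => l l'; rewrite {}/l'.
have := Lp' l; rewrite Lp => /(congr1 (fun x => p'.1 a * x * (p'.1 a)^-1)%g).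
by rewrite !mulgA mulgV mul1g mulgK => <-; rewrite invgM invgK !mulgA.
Qed.

Lemma lifts_bij_pair_classes :
  set_bij [set L | is_lift chi L] (pair_classes a ub) (lift_class ub fr).
Proof.
have classE p L : admissible ub p -> defines_lift ub fr p L ->
    lift_class ub fr L = [set p' | admissible ub p' /\ equivalent a ub p p'].
  by move=> pa pL; apply/seteqP; split=> p' [p'a h]; split=> //;
    apply/(equivalent_lift pa p'a pL).
split=> [L /lift_admissible[p pa pL]|L L' /set_mem/lift_admissible[p pa pL] _ e|].
- by exists p => //; rewrite (classE p L).
(* A pair common to both classes determines the lift on every class of loops. *)
- have [_ pL'] : lift_class ub fr L' p by rewrite -e.
  by apply/funext => x; rewrite -(pclass_repr x) pL pL'.
- move=> _ [p pa <-]; have [L hL pL] := admissible_lift pa.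
  by exists L => //; exact: classE.
Qed.

End Lifts.

Theorem theorem5p5 (R : realType) (disp : Order.disp_t) (K : porderType disp)
    (T : symTensorPresheaf K R[i]) (rho : secobj T) (a : K)
    (bundleT : beta_bundle T)
    (S : topologicalGroupType) (compactS : compact [set: S])
    (hausdorffS : hausdorff_space S)
    (E : dualEmbedding (beta_tensor T a) S)
    (u : forall l : kpath a a, unitaryTransf E (holonomy_aut bundleT l))
    (frame : path_frame a) :
  pathwise_connected K ->
  DR_presheaf T ->
  let G := image_group E compactS rho in
  exists u_rho : kpath a a -> normalizer G,
    (forall l : kpath a a, val (u_rho l) = u l rho) /\
    exists chi : {multiplicative pi1 a -> outer G},
      (forall l : kpath a a, chi (pclass l) = outer_proj G (u_rho l)) /\
      let ub : simplex1 K -> normalizer G :=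
        fun b => u_rho (frame_loop frame b) in
      (forall c : simplex2 K, in_group (cobound ub c)) /\
      set_bij [set L | is_lift chi L] (pair_classes a ub)
        (lift_class ub frame).
Proof.
move=> _ drT G; exists (holonomy_unitary rho compactS u drT); split=> //.
have [chi chiE] := holonomy_morphism rho compactS u drT.
exists chi; split=> // ub.
have chiM : {morph chi : x y / (x * y)%g} by exact: gmulfM.
have chi_ub b : outer_proj G (ub b) = chi (frame_class frame b).
  by rewrite chiE.
split; first by move=> c; exact: (cobound_in_group chiM chi_ub).
exact: (lifts_bij_pair_classes chiM chi_ub).
Qed.
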